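(* Let $(\Omega,\mathcal{H},\hat{E})$ be a sublinear expectation space and let $\{X_i\}_{i=1}^{\infty}$ be a sequence of $\mathbb{R}^d$-valued random variables in it satisfying the following conditions: (i) for every $i\ge 1$, $X_{i+1}$ is independent from $(X_1,\ldots,X_i)$; (ii) $\hat{E}[X_i]=\hat{E}[-X_i]=0$ for every $i\ge 1$ (componentwise); (iii) there is a constant $M>0$ such that $\hat{E}[|X_i|^3]\le M$ for all $i\ge 1$; (iv) there exist a sequence $\{a_n\}$ of positive numbers and a sublinear function $G:\mathbb{S}(d)\to\mathbb{R}$ such that $\lim_{n\to\infty}\frac{a_1+\cdots+a_n}{n}=0$ and $$|G_n(A)-G(A)|\le a_n\|A\|\quad\text{for all } n\ge 1,\ A\in\mathbb{S}(d),$$ where $G_i(A)=\frac12\hat{E}[\langle AX_i,X_i\rangle]$. Let $S_n=X_1+\cdots+X_n$. Then $\{S_n/\sqrt{n}\}_{n=1}^\infty$ converges in law to the $G$-normal distribution $N(0;\Theta)$, i.e. $$\lim_{n\to\infty}\hat{E}\left[\varphi\left(\frac{S_n}{\sqrt n}\right)\right]=\hat{E}[\varphi(X)]\quad\text{for all }\varphi\in C_{b,Lip}(\mathbb{R}^d),$$ where $X\sim N(0;\Theta)$ is the $G$-normal distributed random vector associated with $G$.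
   Context: Sublinear expectation space: $\Omega$ is a set and $\mathcal{H}$ is a linear space of real functions on $\Omega$ containing the constants, closed under $X\mapsto|X|$, and such that $\varphi(X_1,\ldots,X_n)\in\mathcal{H}$ whenever $X_1,\ldots,X_n\in\mathcal{H}$ and $\varphi\in C_{l,Lip}(\mathbb{R}^n)$. Here $C_{l,Lip}(\mathbb{R}^n)$ is the space of $\varphi:\mathbb{R}^n\to\mathbb{R}$ with $|\varphi(x)-\varphi(y)|\le C(1+|x|^m+|y|^m)|x-y|$ for all $x,y$, for some $C>0$, $m\in\mathbb{N}$ depending on $\varphi$; $C_{b,Lip}(\mathbb{R}^n)$ is the space of bounded Lipschitz functions. A sublinear expectation is a functional $\hat{E}:\mathcal{H}\to\mathbb{R}$ that is monotone ($X\ge Y\Rightarrow\hat{E}[X]\ge\hat{E}[Y]$), constant preserving ($\hat{E}[c]=c$), sub-additive ($\hat{E}[X+Y]\le\hat{E}[X]+\hat{E}[Y]$) and positively homogeneous ($\hat{E}[\lambda X]=\lambda\hat{E}[X]$, $\lambda\ge0$). An $\mathbb{R}^d$-valued random variable is an element of $\mathcal{H}^d$. Independence: $Y\in\mathcal{H}^n$ is independent from $X\in\mathcal{H}^m$ if $\hat{E}[\varphi(X,Y)]=\hat{E}\big[\hat{E}[\varphi(x,Y)]|_{x=X}\big]$ for all $\varphi\in C_{l,Lip}(\mathbb{R}^{n+m})$. Random vectors $X_1,X_2$ in $\mathbb{R}^n$ (possibly on different spaces with expectations $E_1,E_2$) are identically distributed, $X_1\sim X_2$, if $E_1[\varphi(X_1)]=E_2[\varphi(X_2)]$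 for all $\varphi\in C_{b,Lip}(\mathbb{R}^n)$. An independent copy $\bar X$ of $X$ is a random vector with $\bar X\sim X$ that is independent from $X$. $\mathbb{S}(d)$ is the space of real symmetric $d\times d$ matrices, $\|A\|=\sqrt{\sum_{i,j=1}^d a_{ij}^2}$ for $A=(a_{ij})$, and $\mathbb{S}_+(d)$ is the set of positive semidefinite elements of $\mathbb{S}(d)$. A sublinear function is one that is sub-additive and positively homogeneous. $G$-normal distribution: a $d$-dimensional random vector $X$ is $G$-normal distributed if $aX+b\bar X\sim\sqrt{a^2+b^2}\,X$ for all $a,b\ge0$, where $\bar X$ is an independent copy of $X$. The associated function is $G(A)=\hat{E}[\frac12\langle AX,X\rangle]$, $A\in\mathbb{S}(d)$; it determines the law of $X$. There is a bounded, convex, closed set $\Theta\subset\mathbb{S}_+(d)$ with $G(A)=\frac12\sup_{Q\in\Theta}\mathrm{tr}[AQ]$, and one writes $X\sim N(0;\Theta)$. Thus, for a given $G$, $X\sim N(0;\Theta)$ means that $X$ is $G$-normal distributed with $\hat{E}[\frac12\langle AX,X\rangle]=G(A)=\frac12\sup_{Q\in\Theta}\mathrm{tr}[AQ]$. The vector $X$ may live on another sublinear expectation space, whose expectation is still denoted $\hat{E}$. Equivalently, $u(t,x)=\hat{E}[\varphi(x+\sqrt t X)]$ is the unique viscosity solution on $[0,\infty)\times\mathbb{R}^d$ of $\partial_tu-G(D^2u)=0$, $u|_{t=0}=\varphi$, for $\varphi\in C_{b,Lip}(\mathbb{R}^d)$. *)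

(* Defs.v *)
From HB Require Import structures.
From mathcomp Require Import all_boot all_order all_algebra.
From mathcomp Require Import all_classical all_reals all_analysis.

Set Implicit Arguments.
Unset Strict Implicit.
Unset Printing Implicit Defensive.

Import Order.TTheory GRing.Theory Num.Theory.
Import numFieldNormedType.Exports.

Local Open Scope classical_set_scope.
Local Open Scope ring_scope.

(* The norm of 'rV[R]_n in the library is the sup norm, hence these Euclidean
   (resp. Frobenius) norms. *)
Definition enorm (R : realType) (n : nat) (x : 'rV[R]_n) : R :=
  Num.sqrt (\sum_i x 0 i ^+ 2).

Definition fnorm (R : realType) (m n : nat) (A : 'M[R]_(m, n)) : R :=
  Num.sqrt (\sum_i \sum_j A i j ^+ 2).

(* <A x, x>, for x a row vector *)
Definition quadform (R : realType) (d : nat) (A : 'M[R]_d) (x : 'rV[R]_d) : R :=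
  (x *m A *m x^T) 0 0.

Definition C_lLip (R : realType) (n : nat) (phi : 'rV[R]_n -> R) : Prop :=
  exists (C : R) (m : nat), 0 < C /\
    forall x y, `|phi x - phi y|
                <= C * (1 + enorm x ^+ m + enorm y ^+ m) * enorm (x - y).

Definition C_bLip (R : realType) (n : nat) (phi : 'rV[R]_n -> R) : Prop :=
  (exists B : R, forall x, `|phi x| <= B) /\
  (exists L : R, forall x y, `|phi x - phi y| <= L * enorm (x - y)).

(* [rvs] is the space H. [expect] is total on functions Omega -> R, but it is
   only constrained on [rvs]; its values elsewhere are meaningless. *)
Record sublinear_space (R : realType) (Omega : Type) := SublinearSpace {
  rvs : set (Omega -> R) ;
  expect : (Omega -> R) -> R ;
  rvs_cst : forall c : R, rvs (fun=> c) ;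
  rvs_add : forall X Y, rvs X -> rvs Y -> rvs (fun w => X w + Y w) ;
  rvs_scale : forall (c : R) X, rvs X -> rvs (fun w => c * X w) ;
  rvs_abs : forall X, rvs X -> rvs (fun w => `|X w|) ;
  rvs_comp : forall (n : nat) (X : Omega -> 'rV[R]_n) (phi : 'rV[R]_n -> R),
    (forall i, rvs (fun w => X w 0 i)) -> C_lLip phi ->
    rvs (fun w => phi (X w)) ;
  expect_mono : forall X Y, rvs X -> rvs Y -> (forall w, Y w <= X w) ->
    expect Y <= expect X ;
  expect_cst : forall c : R, expect (fun=> c) = c ;
  expect_subadd : forall X Y, rvs X -> rvs Y ->
    expect (fun w => X w + Y w) <= expect X + expect Y ;
  expect_poshom : forall (c : R) X, 0 <= c -> rvs X ->
    expect (fun w => c * X w) = c * expect X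
}.

Definition random_vector (R : realType) (Omega : Type)
    (S : sublinear_space R Omega) (n : nat) (X : Omega -> 'rV[R]_n) : Prop :=
  forall i, rvs S (fun w => X w 0 i).

Definition independent_from (R : realType) (Omega : Type)
    (S : sublinear_space R Omega) (m n : nat)
    (Y : Omega -> 'rV[R]_n) (X : Omega -> 'rV[R]_m) : Prop :=
  forall phi : 'rV[R]_(m + n) -> R, C_lLip phi ->
    expect S (fun w => phi (row_mx (X w) (Y w))) =
    expect S (fun w => expect S (fun w' => phi (row_mx (X w) (Y w')))).

Definition ident_dist (R : realType) (n : nat)
    (Omega1 : Type) (S1 : sublinear_space R Omega1) (X1 : Omega1 -> 'rV[R]_n)
    (Omega2 : Type) (S2 : sublinear_space R Omega2) (X2 : Omega2 -> 'rV[R]_n)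
    : Prop :=
  forall phi : 'rV[R]_n -> R, C_bLip phi ->
    expect S1 (fun w => phi (X1 w)) = expect S2 (fun w => phi (X2 w)).

Definition independent_copy (R : realType) (Omega : Type)
    (S : sublinear_space R Omega) (n : nat)
    (Xbar X : Omega -> 'rV[R]_n) : Prop :=
  [/\ random_vector S Xbar, ident_dist S Xbar S X & independent_from S Xbar X].

(* The copy is required to exist, since quantifying over all the copies in Omega
   would be vacuous on a space that has none. The law of a X + b Xbar does not
   depend on the choice of the copy. *)
Definition G_normal (R : realType) (Omega : Type) (S : sublinear_space R Omega)
    (d : nat) (X : Omega -> 'rV[R]_d) : Prop :=
  random_vector S X /\
  exists Xbar : Omega -> 'rV[R]_d, independent_copy S Xbar X /\
    forall a b : R, 0 <= a -> 0 <= b ->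
      ident_dist S (fun w => a *: X w + b *: Xbar w)
                 S (fun w => Num.sqrt (a ^+ 2 + b ^+ 2) *: X w).

(* Functions on the space of symmetric matrices are represented by functions on
   'M[R]_d, whose values are only constrained (and used) at symmetric matrices. *)
Definition sublinear_on_sym (R : realType) (d : nat) (G : 'M[R]_d -> R) : Prop :=
  (forall A B, A \is symmetricmx -> B \is symmetricmx -> G (A + B) <= G A + G B) /\
  (forall (c : R) A, 0 <= c -> A \is symmetricmx -> G (c *: A) = c * G A).

Definition psd (R : realType) (d : nat) (Q : 'M[R]_d) : Prop :=
  Q \is symmetricmx /\ forall x : 'rV[R]_d, 0 <= quadform Q x.

(* Non-emptiness makes the supremum below a genuine one. *)
Definition covariance_set (R : realType) (d : nat) (Theta : set 'M[R]_d) : Prop :=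
  [/\ Theta `<=` @psd R d,
      Theta !=set0,
      (exists B : R, forall Q, Theta Q -> fnorm Q <= B),
      convex_set Theta &
      closed Theta].

Definition half_sup_tr (R : realType) (d : nat) (Theta : set 'M[R]_d)
    (A : 'M[R]_d) : R :=
  2^-1 * sup [set \tr (A *m Q) | Q in Theta].

Definition normal_dist (R : realType) (Omega : Type)
    (S : sublinear_space R Omega) (d : nat) (G : 'M[R]_d -> R)
    (Theta : set 'M[R]_d) (X : Omega -> 'rV[R]_d) : Prop :=
  [/\ covariance_set Theta,
      G_normal S X,
      (forall A, A \is symmetricmx ->
        expect S (fun w => 2^-1 * quadform A (X w)) = G A) &
      (forall A, A \is symmetricmx -> G A = half_sup_tr Theta A)].

(* (X_1, ..., X_i) as a vector of R^(i d), for a sequence indexed from 1 *)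
Definition initial_vector (R : realType) (Omega : Type) (d : nat)
    (X : nat -> Omega -> 'rV[R]_d) (i : nat) (w : Omega) : 'rV[R]_(i * d) :=
  mxvec (\matrix_(k < i) X k.+1 w).

(* Main.v *)
(* Write A_k f x := E[f (x + c X_k)] and B f x := E[f (x + c N)], c = 1/sqrt n.
   By independence E[phi (c S_n)] = (A_1 ... A_n phi) 0, and by the stability of
   the normal law E[phi N] = (B^n phi) 0. Both are products of sublinear,
   translation-invariant operators with the same second-order behaviour, and no
   regularity theory for the G-heat equation is needed to compare them: let W be
   an average over translations, so that A_k (W f) <= W (A_k f) by sublinearity,
   and put v_k := W (A_(k+1) ... A_n phi). This function is smooth, with bounds
   that depend only on W and on the Lipschitz constant of phi, hence a Taylor
   expansion gives B v_k <= A_k v_k + err <= v_(k-1) + err, and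
   B^n phi <= A_1 ... A_n phi + errors follows by induction. The roles of A_k and
   B can be exchanged. W averages over finite grids, twice in each coordinate
   direction, so that the partial derivatives are difference quotients; the mesh
   goes to 0 first, then n to infinity, then the width of W to 0. *)
Require Import Defs.
From HB Require Import structures.
From mathcomp Require Import all_boot all_order all_algebra.
From mathcomp Require Import all_classical all_reals all_analysis.
From mathcomp Require Import ring lra.

Set Implicit Arguments.
Unset Strict Implicit.
Unset Printing Implicit Defensive.

Import Order.TTheory GRing.Theory Num.Theory.
Import numFieldNormedType.Exports.

Local Open Scope classical_set_scope.
Local Open Scope ring_scope.

(** * Lipschitz functions, grid averages and difference quotients *)

Definition l1norm (R : realType) (d : nat) (x : 'rV[R]_d) : R :=
  \sum_i `|x 0 i|.

(** The expansions below move along one coordinate at a time, which makes the l1 norm convenient; it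
    is comparable with [enorm] up to the factor d. *)
Definition lip (R : realType) (d : nat) (L : R) (f : 'rV[R]_d -> R) : Prop :=
  forall x h, `|f (x + h) - f x| <= L * l1norm h.

(** A Riemann sum for the mean of [f] over a segment of length [K eta]. The sum is finite because
    sub-additivity alone, without any continuity of the expectation, only reaches finite sums. *)
Definition avg (R : realType) (d : nat) (K : nat) (eta : R) (i : 'I_d)
    (f : 'rV[R]_d -> R) (x : 'rV[R]_d) : R :=
  K%:R^-1 * \sum_(j < K) f (x + (j%:R * eta) *: delta_mx 0 i).

Definition dquot (R : realType) (d : nat) (eps : R) (i : 'I_d)
    (f : 'rV[R]_d -> R) (x : 'rV[R]_d) : R :=
  eps^-1 * (f (x + eps *: delta_mx 0 i) - f x).

Definition avgs (R : realType) (d : nat) (K : nat) (eta : R) (s : seq 'I_d)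
    (f : 'rV[R]_d -> R) : 'rV[R]_d -> R :=
  foldr (avg K eta) f s.

Lemma l1norm_ge0 (R : realType) (d : nat) (x : 'rV[R]_d) : 0 <= l1norm x.
Proof. exact: sumr_ge0. Qed.

Lemma l1norm_delta (R : realType) (d : nat) (t : R) (i : 'I_d) :
  l1norm (t *: delta_mx 0 i) = `|t|.
Proof.
rewrite /l1norm (bigD1 i) //= big1 => [|j /negbTE ji].
  by rewrite !mxE !eqxx mulr1 addr0.
by rewrite !mxE ji andbF mulr0 normr0.
Qed.

Lemma l1norm_scale (R : realType) (d : nat) (t : R) (x : 'rV[R]_d) :
  l1norm (t *: x) = `|t| * l1norm x.
Proof.
by rewrite /l1norm mulr_sumr; apply: eq_bigr => i _; rewrite mxE normrM.
Qed.

(** In dimension 0 every function is [lip L] for every real L; the index [i] excludes this case. *)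
Lemma lip_ge0 (R : realType) (d : nat) (L : R) (f : 'rV[R]_d -> R) (i : 'I_d) :
  lip L f -> 0 <= L.
Proof.
move=> /(_ 0 (1 *: delta_mx 0 i)); rewrite l1norm_delta normr1 mulr1.
exact: le_trans.
Qed.

Lemma lip_dquot (R : realType) (d : nat) (L eps : R) (i : 'I_d)
    (f : 'rV[R]_d -> R) :
  0 < eps -> lip L f -> lip (2 * L / eps) (dquot eps i f).
Proof.
move=> e0 fL x h; rewrite /dquot -mulrBr normrM gtr0_norm ?invr_gt0//.
have -> : 2 * L / eps * l1norm h = eps^-1 * (2 * (L * l1norm h)) by ring.
rewrite ler_pM2l ?invr_gt0//.
rewrite [x + h + _]addrAC; have := fL (x + eps *: delta_mx 0 i) h; have := fL x h.
rewrite !ler_norml => /andP[? ?] /andP[? ?]; apply/andP; split; lra.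
Qed.

Lemma dquot_bound (R : realType) (d : nat) (L eps : R) (i : 'I_d)
    (f : 'rV[R]_d -> R) (x : 'rV[R]_d) :
  0 < eps -> lip L f -> `|dquot eps i f x| <= L.
Proof.
move=> e0 fL; rewrite /dquot normrM gtr0_norm ?invr_gt0// ler_pdivrMl//.
by have := fL x (eps *: delta_mx 0 i); rewrite l1norm_delta (gtr0_norm e0) mulrC.
Qed.

Lemma sum_le_const (R : realType) (k : nat) (B : R) (g : 'I_k -> R) :
  (forall j, g j <= B) -> \sum_(j < k) g j <= k%:R * B.
Proof.
move=> gB; apply: le_trans (ler_sum _ (fun j _ => gB j)) _.
by rewrite sumr_const card_ord mulr_natl.
Qed.

Lemma mean_bound (R : realType) (K : nat) (B : R) (g : nat -> R) :
  (0 < K)%N -> (forall j, `|g j| <= B) ->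
  `|K%:R^-1 * \sum_(j < K) g j| <= B.
Proof.
move=> K0 gB; rewrite normrM gtr0_norm ?invr_gt0 ?ltr0n//.
rewrite ler_pdivrMl ?ltr0n//; apply: le_trans (ler_norm_sum _ _ _) _.
exact: sum_le_const.
Qed.

Lemma avg_bound (R : realType) (d K : nat) (eta B : R) (i : 'I_d)
    (f : 'rV[R]_d -> R) :
  (0 < K)%N -> (forall x, `|f x| <= B) -> forall x, `|avg K eta i f x| <= B.
Proof.
move=> K0 fB x.
exact: (mean_bound (g := fun j => f (x + (j%:R * eta) *: delta_mx 0 i))).
Qed.

Lemma avgs_bound (R : realType) (d K : nat) (eta B : R) (s : seq 'I_d)
    (f : 'rV[R]_d -> R) :
  (0 < K)%N -> (forall x, `|f x| <= B) -> forall x, `|avgs K eta s f x| <= B.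
Proof. by move=> K0 fB; elim: s => //= i s IH; exact: avg_bound. Qed.

Lemma lip_avg (R : realType) (d K : nat) (eta L : R) (i : 'I_d)
    (f : 'rV[R]_d -> R) :
  (0 < K)%N -> lip L f -> lip L (avg K eta i f).
Proof.
move=> K0 fL x h; rewrite /avg -mulrBr -sumrB.
pose g (j : nat) := f (x + h + (j%:R * eta) *: delta_mx 0 i) -
  f (x + (j%:R * eta) *: delta_mx 0 i).
by apply: (mean_bound (g := g)) => // j; rewrite /g addrAC.
Qed.

Lemma lip_avgs (R : realType) (d K : nat) (eta L : R) (s : seq 'I_d)
    (f : 'rV[R]_d -> R) :
  (0 < K)%N -> lip L f -> lip L (avgs K eta s f).
Proof. by move=> K0 fL; elim: s => //= i s IH; exact: lip_avg. Qed.

Lemma avg_near (R : realType) (d K : nat) (eta L : R) (i : 'I_d)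
    (f : 'rV[R]_d -> R) (x : 'rV[R]_d) :
  (0 < K)%N -> 0 <= eta -> lip L f ->
  `|avg K eta i f x - f x| <= L * (K%:R * eta).
Proof.
move=> K0 eta0 fL; have L0 := lip_ge0 i fL.
have -> : avg K eta i f x - f x = K%:R^-1 *
    \sum_(j < K) (f (x + (j%:R * eta) *: delta_mx 0 i) - f x).
  rewrite sumrB mulrBr sumr_const card_ord -[X in _ = _ - _ * X]mulr_natl mulKf//.
  by rewrite pnatr_eq0 -lt0n.
rewrite normrM gtr0_norm ?invr_gt0 ?ltr0n//.
rewrite ler_pdivrMl ?ltr0n//; apply: le_trans (ler_norm_sum _ _ _) _.
apply: sum_le_const => j.
apply: le_trans (fL _ _) _; rewrite l1norm_delta ger0_norm ?mulr_ge0//.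
by rewrite !ler_wpM2l// ler_wpM2r// ler_nat ltnW.
Qed.

Lemma avgs_near (R : realType) (d K : nat) (eta L : R) (s : seq 'I_d)
    (f : 'rV[R]_d -> R) (x : 'rV[R]_d) :
  (0 < K)%N -> 0 <= eta -> lip L f ->
  `|avgs K eta s f x - f x| <= (size s)%:R * (L * (K%:R * eta)).
Proof.
move=> K0 eta0 fL; elim: s x => [|i s IH] x /=; first by rewrite subrr normr0 mul0r.
have h1 := avg_near i x K0 eta0 (lip_avgs eta s K0 fL).
rewrite -natr1 mulrDl mul1r; have := IH x; move: h1.
rewrite !ler_norml => /andP[? ?] /andP[? ?]; apply/andP; split; lra.
Qed.

Lemma avgC (R : realType) (d K : nat) (eta : R) (i j : 'I_d)
    (f : 'rV[R]_d -> R) :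
  avg K eta i (avg K eta j f) = avg K eta j (avg K eta i f).
Proof.
apply/funext => x; rewrite /avg -!mulr_sumr; congr (_ * (_ * _)).
rewrite exchange_big /=; apply: eq_bigr => a _; apply: eq_bigr => b _.
by rewrite addrAC.
Qed.

Lemma avg_dquot (R : realType) (d K : nat) (eta eps : R) (i j : 'I_d)
    (f : 'rV[R]_d -> R) :
  dquot eps j (avg K eta i f) = avg K eta i (dquot eps j f).
Proof.
apply/funext => x; rewrite /avg /dquot -mulr_sumr -mulrBr mulrCA -sumrB.
by congr (_ * (_ * _)); apply: eq_bigr => a _; rewrite addrAC.
Qed.

Lemma avgs_dquot (R : realType) (d K : nat) (eta eps : R) (s : seq 'I_d)
    (j : 'I_d) (f : 'rV[R]_d -> R) :
  dquot eps j (avgs K eta s f) = avgs K eta s (dquot eps j f).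
Proof. by elim: s => //= i s IH; rewrite avg_dquot IH. Qed.

(** Averages commute, so any direction in [s] can be made the outermost one, where it is turned into
    a difference quotient. *)
Lemma avgs_rem (R : realType) (d K : nat) (eta : R) (s : seq 'I_d)
    (i : 'I_d) (f : 'rV[R]_d -> R) : i \in s ->
  avgs K eta s f = avg K eta i (avgs K eta (rem i s) f).
Proof.
elim: s => //= j s IH; rewrite inE; case: eqVneq => [-> //|ij /= si].
by rewrite IH//= avgC.
Qed.

(** * Taylor expansion of grid averages *)

Lemma sum_shift (R : realType) (K k : nat) (g : nat -> R) :
  \sum_(j < K) g (k + j)%N - \sum_(j < K) g j =
  \sum_(j < k) (g (j + K)%N - g j).
Proof.
elim: k => [|k IH]; first by rewrite big_ord0 subrr.
rewrite big_ord_recr/= -IH.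
have e1 : \sum_(j < K.+1) g (k + j)%N = \sum_(j < K) g (k + j)%N + g (k + K)%N.
  exact: big_ord_recr.
have e2 : \sum_(j < K.+1) g (k + j)%N = g k + \sum_(j < K) g (k.+1 + j)%N.
  rewrite big_ord_recl/= addn0; congr (_ + _).
  by apply: eq_bigr => j _; rewrite /bump/= add1n addnS.
by move: e1; rewrite e2; lra.
Qed.

(** This is the discrete formula for the derivative of a sliding mean. Shifting a window of K points
    by k points only exchanges points at its two ends, which lie [K eta] apart. The width of the
    quotient is thus that of the window, and can stay fixed while the mesh [eta] goes to 0. *)
Lemma avg_grid (R : realType) (d K : nat) (eta : R) (i : 'I_d)
    (f : 'rV[R]_d -> R) (x : 'rV[R]_d) (k : nat) : (0 < K)%N -> 0 < eta ->
  avg K eta i f (x + (k%:R * eta) *: delta_mx 0 i) - avg K eta i f x =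
  eta * \sum_(j < k) dquot (K%:R * eta) i f (x + (j%:R * eta) *: delta_mx 0 i).
Proof.
move=> K0 eta0; pose g (j : nat) := f (x + (j%:R * eta) *: delta_mx 0 i).
have gE (a b : nat) : f (x + (a%:R * eta) *: delta_mx 0 i +
    (b%:R * eta) *: delta_mx 0 i) = g (a + b)%N.
  by rewrite /g natrD mulrDl scalerDl addrA.
rewrite /avg /dquot -mulrBr; under eq_bigr do rewrite gE.
under [in RHS]eq_bigr do rewrite gE.
rewrite -mulr_sumr mulrA -(sum_shift K k g) invfM mulrCA mulfV ?gt_eqF// mulr1.
by [].
Qed.

(** Round t down to a grid point [k eta]. On the grid [avg_grid] is exact, and the quotients it
    contains differ from the one at x by their Lipschitz bound, which gives the quadratic term.
    Rounding costs [L eta] in the average and [L eta] in the linear term. *)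
Lemma avg_dir_ge0 (R : realType) (d K : nat) (eta L : R) (i : 'I_d)
    (f : 'rV[R]_d -> R) (x : 'rV[R]_d) (t : R) :
  (0 < K)%N -> 0 < eta -> lip L f -> 0 <= t ->
  `|avg K eta i f (x + t *: delta_mx 0 i) - avg K eta i f x
    - t * dquot (K%:R * eta) i f x|
  <= 2 * L / (K%:R * eta) * t ^+ 2 + 2 * L * eta.
Proof.
move=> K0 eta0 fL t0; have L0 := lip_ge0 i fL.
have e0 : 0 < K%:R * eta :> R by rewrite mulr_gt0 ?ltr0n.
set D := dquot _ i f; set F := avg K eta i f.
have DL : lip (2 * L / (K%:R * eta)) D by exact: lip_dquot.
set L' := 2 * L / _ in DL *.
have L'0 : 0 <= L' by rewrite divr_ge0 ?(ltW e0)// mulr_ge0.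
pose k := Num.trunc (t / eta).
have /andP[k1 k2] : k%:R <= t / eta < k.+1%:R.
  by apply: truncn_itv; rewrite divr_ge0// ltW.
rewrite ler_pdivlMr// in k1; rewrite ltr_pdivrMr// -natr1 in k2.
have h1 : `|F (x + t *: delta_mx 0 i) - F (x + (k%:R * eta) *: delta_mx 0 i)|
    <= L * eta.
  have := lip_avg eta i K0 fL (x + (k%:R * eta) *: delta_mx 0 i)
    ((t - k%:R * eta) *: delta_mx 0 i).
  rewrite -addrA -scalerDl [_ + (t - _)]addrC subrK l1norm_delta => /le_trans; apply.
  by rewrite ler_wpM2l// ger0_norm; lra.
have h2 : `|F (x + (k%:R * eta) *: delta_mx 0 i) - F x - (k%:R * eta) * D x|
    <= L' * (k%:R * eta) ^+ 2.
  rewrite avg_grid// -/D (_ : k%:R * eta * D x = eta * \sum_(j < k) D x); last first.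
    by rewrite sumr_const card_ord -mulr_natl; ring.
  rewrite -mulrBr -sumrB normrM gtr0_norm//.
  have -> : L' * (k%:R * eta) ^+ 2 = eta * (k%:R * (L' * (k%:R * eta))) by ring.
  rewrite ler_pM2l//; apply: le_trans (ler_norm_sum _ _ _) _.
  apply: sum_le_const => j.
  apply: le_trans (DL _ _) _; rewrite l1norm_delta ger0_norm ?mulr_ge0 ?(ltW eta0)//.
  by rewrite ler_wpM2l// ler_wpM2r ?(ltW eta0)// ler_nat ltnW.
have h3 : `|(t - k%:R * eta) * D x| <= eta * L.
  rewrite normrM ler_pM//; first by rewrite ger0_norm; lra.
  exact: dquot_bound.
have h4 : L' * (k%:R * eta) ^+ 2 <= L' * t ^+ 2.
  by rewrite ler_wpM2l// ler_pXn2r// ?nnegrE// mulr_ge0// ltW.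
move: h1 h2 h3; rewrite !ler_norml => /andP[? ?] /andP[? ?] /andP[? ?].
by apply/andP; split; lra.
Qed.

(** For t < 0 the expansion is made at the other endpoint, with the increment -t. Carrying the
    quotient back to x costs one more quadratic term, hence 4 in place of 2. *)
Lemma avg_dir (R : realType) (d K : nat) (eta L : R) (i : 'I_d)
    (f : 'rV[R]_d -> R) (x : 'rV[R]_d) (t : R) :
  (0 < K)%N -> 0 < eta -> lip L f ->
  `|avg K eta i f (x + t *: delta_mx 0 i) - avg K eta i f x
    - t * dquot (K%:R * eta) i f x|
  <= 4 * L / (K%:R * eta) * t ^+ 2 + 2 * L * eta.
Proof.
move=> K0 eta0 fL; have L0 := lip_ge0 i fL.
have e0 : 0 < K%:R * eta :> R by rewrite mulr_gt0 ?ltr0n.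
have -> : 4 * L / (K%:R * eta) = 2 * (2 * L / (K%:R * eta)) by ring.
have A0 : 0 <= 2 * L / (K%:R * eta) * t ^+ 2.
  by rewrite mulr_ge0 ?sqr_ge0// divr_ge0 ?(ltW e0)// mulr_ge0.
have [t0|t0] := leP 0 t; first by have := avg_dir_ge0 i x K0 eta0 fL t0; lra.
have mt0 : 0 <= - t by lra.
have := avg_dir_ge0 i (x + t *: delta_mx 0 i) K0 eta0 fL mt0.
rewrite scaleNr addrK sqrrN.
have := lip_dquot i e0 fL x (t *: delta_mx 0 i); rewrite l1norm_delta.
set D := dquot _ i f; set F := avg K eta i f.
move=> h; have {}h : `|t * (D (x + t *: delta_mx 0 i) - D x)|
    <= 2 * L / (K%:R * eta) * t ^+ 2.
  rewrite normrM; apply: le_trans (ler_wpM2l _ h) _ => //.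
  by rewrite -[t ^+ 2]real_normK ?num_real// expr2 mulrCA.
move: h; rewrite !ler_norml => /andP[? ?] /andP[? ?].
by apply/andP; split; lra.
Qed.

(** One average in direction i is spent on the derivative; the others stay and still smooth the
    quotient. *)
Lemma avgs_dir (R : realType) (d K : nat) (eta L : R) (s : seq 'I_d)
    (i : 'I_d) (f : 'rV[R]_d -> R) (x : 'rV[R]_d) (t : R) :
  (0 < K)%N -> 0 < eta -> lip L f -> i \in s ->
  `|avgs K eta s f (x + t *: delta_mx 0 i) - avgs K eta s f x
    - t * avgs K eta (rem i s) (dquot (K%:R * eta) i f) x|
  <= 4 * L / (K%:R * eta) * t ^+ 2 + 2 * L * eta.
Proof.
move=> K0 eta0 fL si; rewrite (avgs_rem _ _ _ si) -avgs_dquot.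
exact/avg_dir/lip_avgs.
Qed.

Lemma l1norm_sum (R : realType) (d : nat) (h : 'I_d -> R) (r : seq 'I_d) :
  l1norm (\sum_(i <- r) h i *: delta_mx 0 i) <= \sum_(i <- r) `|h i|.
Proof.
elim: r => [|i r IH].
  by rewrite !big_nil /l1norm big1// => j _; rewrite mxE normr0.
rewrite !big_cons; apply: le_trans (lerD (lexx _) IH).
rewrite -(l1norm_delta (h i) i) /l1norm -big_split /=.
by apply: ler_sum => j _; rewrite mxE ler_normD.
Qed.

(** Walk from x to x + h along the coordinates listed in [r]. Each leg is expanded at its own
    starting point, and its quotient is then moved back to x by the Lipschitz bound. *)
Lemma avgs_path (R : realType) (d K : nat) (eta L : R) (s : seq 'I_d)
    (f : 'rV[R]_d -> R) (x : 'rV[R]_d) (h : 'I_d -> R) (r : seq 'I_d) :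
  (0 < K)%N -> 0 < eta -> lip L f -> (forall i, i \in s) ->
  `|avgs K eta s f (x + \sum_(i <- r) h i *: delta_mx 0 i) - avgs K eta s f x
    - \sum_(i <- r) h i * avgs K eta (rem i s) (dquot (K%:R * eta) i f) x|
  <= 4 * L / (K%:R * eta) * (\sum_(i <- r) `|h i|) ^+ 2
     + (size r)%:R * (2 * L * eta).
Proof.
move=> K0 eta0 fL sT; have e0 : 0 < K%:R * eta :> R by rewrite mulr_gt0 ?ltr0n.
elim: r => [|i r IH].
  by rewrite !big_nil addr0 subr0 subrr normr0 expr0n/= mulr0 mul0r addr0.
rewrite !big_cons /=; have L0 := lip_ge0 i fL.
have : 0 <= \sum_(i <- r) `|h i| by exact: sumr_ge0.
move: IH (l1norm_sum h r).
set y := \sum_(i <- r) h i *: _; set b := \sum_(i <- r) `|h i| => IH yb b0.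
have h1 := avgs_dir (x + y) (h i) K0 eta0 fL (sT i).
have h2 := lip_avgs eta (rem i s) K0 (lip_dquot i e0 fL) x y.
set p := avgs K eta (rem i s) _ in h1 h2 *; set F := avgs K eta s f in IH h1 *.
rewrite (addrC (_ *: _)) addrA.
have -> : (size r).+1%:R * (2 * L * eta) = (size r)%:R * (2 * L * eta) + 2 * L * eta.
  by rewrite -natr1; ring.
have -> : 4 * L / (K%:R * eta) = 2 * (2 * L / (K%:R * eta)) by ring.
have E4 : 4 * L / (K%:R * eta) = 2 * (2 * L / (K%:R * eta)) by ring.
rewrite E4 in h1 IH; set c := 2 * L / _ in h1 h2 IH *.
have c0 : 0 <= c by rewrite divr_ge0 ?(ltW e0)// mulr_ge0.
have {}h2 : `|h i * (p (x + y) - p x)| <= c * (`|h i| * b).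
  rewrite normrM mulrCA ler_wpM2l//; apply: le_trans h2 _.
  by rewrite ler_wpM2l.
(* The square of the longer path leaves a cross term [4 c |h_i| b], which covers the [c |h_i| b]
   spent on moving the quotient from x + y to x. *)
have -> : 2 * c * (`|h i| + b) ^+ 2 =
    2 * c * h i ^+ 2 + 2 * c * b ^+ 2 + 4 * (c * (`|h i| * b)).
  by rewrite -[h i ^+ 2]real_normK ?num_real//; ring.
have : 0 <= c * (`|h i| * b) := mulr_ge0 c0 (mulr_ge0 (normr_ge0 (h i)) b0).
move: IH h1 h2; rewrite !ler_norml => /andP[? ?] /andP[? ?] /andP[? ?] ?.
by apply/andP; split; lra.
Qed.

Lemma avgs_diff (R : realType) (d K : nat) (eta L : R) (s : seq 'I_d)
    (f : 'rV[R]_d -> R) (x h : 'rV[R]_d) :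
  (0 < K)%N -> 0 < eta -> lip L f -> (forall i, i \in s) ->
  `|avgs K eta s f (x + h) - avgs K eta s f x
    - \sum_i h 0 i * avgs K eta (rem i s) (dquot (K%:R * eta) i f) x|
  <= 4 * L / (K%:R * eta) * l1norm h ^+ 2 + d%:R * (2 * L * eta).
Proof.
move=> K0 eta0 fL sT.
have := avgs_path x (fun i => h 0 i) (index_enum 'I_d) K0 eta0 fL sT.
rewrite -row_sum_delta.
suff -> : size (index_enum 'I_d) = d by [].
by rewrite -[RHS]card_ord cardT enumT.
Qed.

(* Because of the mesh errors e1 and e2 the expansions of F and p are not
   derivatives; the segment from x to x + h is cut into m pieces instead. *)
Lemma taylor2 (R : realType) (d : nat) (F : 'rV[R]_d -> R)
    (p : 'I_d -> 'rV[R]_d -> R) (q : 'I_d -> 'I_d -> 'rV[R]_d -> R)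
    (C1 C2 Q e1 e2 : R) (m : nat) (x h : 'rV[R]_d) :
  (0 < m)%N -> 0 <= C2 -> 0 <= Q ->
  (forall x h, `|F (x + h) - F x - \sum_i h 0 i * p i x|
     <= C1 * l1norm h ^+ 2 + e1) ->
  (forall i x h, `|p i (x + h) - p i x - \sum_j h 0 j * q i j x|
     <= C2 * l1norm h ^+ 2 + e2) ->
  (forall i j x, `|q i j x| <= Q) ->
  `|F (x + h) - F x - \sum_i h 0 i * p i x
    - 2^-1 * \sum_i h 0 i * \sum_j h 0 j * q i j x|
  <= C2 * l1norm h ^+ 3 + e2 * l1norm h + (C1 + Q) * l1norm h ^+ 2 / m%:R
     + m%:R * e1.
Proof.
move=> m0 C20 Q0 hF hp hq; have l0 := l1norm_ge0 h.
set P := \sum_i h 0 i * p i x; set c := \sum_i h 0 i * _; set l := l1norm h in l0 *.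
pose u : R := m%:R^-1; have u0 : 0 <= u by rewrite invr_ge0.
have mu : m%:R * u = 1 by rewrite mulfV// pnatr_eq0 -lt0n.
(* The remainder of the second-order expansion at x + (k/m) h. It starts from 0 and each of the m
   steps changes it by at most [B]. *)
pose r (k : nat) := F (x + (k%:R * u) *: h) - F x - k%:R * u * P
  - 2^-1 * (k%:R * u) ^+ 2 * c.
have cQ : `|c| <= Q * l ^+ 2.
  rewrite /c; apply: le_trans (ler_norm_sum _ _ _) _.
  rewrite expr2 mulrCA {2}/l /l1norm mulr_suml; apply: ler_sum => i _.
  rewrite normrM ler_wpM2l//; apply: le_trans (ler_norm_sum _ _ _) _.
  rewrite /l /l1norm mulr_sumr; apply: ler_sum => j _.
  by rewrite normrM mulrC ler_wpM2r.
pose B := C1 * (u * l) ^+ 2 + e1 + u * (l * (C2 * l ^+ 2 + e2))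
  + 2^-1 * u ^+ 2 * (Q * l ^+ 2).
have rS k : (k < m)%N -> `|r k.+1 - r k| <= B.
  move=> km; set t := k%:R * u; have t0 : 0 <= t by rewrite mulr_ge0.
  have t1 : t <= 1 by rewrite -mu ler_wpM2r// ler_nat ltnW.
  have ha := hF (x + t *: h) (u *: h).
  have hb : `|\sum_i h 0 i * (p i (x + t *: h) - p i x - \sum_j (t *: h) 0 j * q i j x)|
      <= l * (C2 * l ^+ 2 + e2).
    apply: le_trans (ler_norm_sum _ _ _) _.
    rewrite {1}/l /l1norm mulr_suml; apply: ler_sum => i _.
    rewrite normrM ler_wpM2l//; apply: le_trans (hp _ _ _) _.
    rewrite lerD2r ler_wpM2l// l1norm_scale (ger0_norm t0) -/l.
    by rewrite ler_pXn2r ?nnegrE ?mulr_ge0// ler_piMl.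
  move: ha hb; rewrite l1norm_scale (ger0_norm u0) -/l.
  have -> : \sum_i (u *: h) 0 i * p i (x + t *: h) =
      u * \sum_i h 0 i * p i (x + t *: h).
    by rewrite mulr_sumr; apply: eq_bigr => i _; rewrite mxE mulrA.
  have -> : \sum_i h 0 i * (p i (x + t *: h) - p i x - \sum_j (t *: h) 0 j * q i j x)
      = \sum_i h 0 i * p i (x + t *: h) - P - t * c.
    rewrite /c mulr_sumr -!sumrB; apply: eq_bigr => i _.
    rewrite !mulrBr; congr (_ - _); rewrite mulrCA; congr (_ * _).
    by rewrite mulr_sumr; apply: eq_bigr => j _; rewrite mxE mulrA.
  set Z := \sum_i h 0 i * p i _ => ha hb.
  (* The first bracket is the expansion of F at x + t h, the second that of the p i at x. Since ((t
     + u)^2 - t^2)/2 = t u + u^2/2, only the term in u^2 is left over. *)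
  have -> : r k.+1 - r k = (F (x + t *: h + u *: h) - F (x + t *: h) - u * Z)
      + u * (Z - P - t * c) - 2^-1 * u ^+ 2 * c.
    rewrite /r -natr1 mulrDl mul1r -/t scalerDl addrA; by field.
  rewrite /B; apply: le_trans (ler_normB _ _) _; apply: lerD.
    apply: le_trans (ler_normD _ _) _; apply: lerD => //.
    by rewrite normrM (ger0_norm u0) ler_wpM2l.
  by rewrite normrM ger0_norm ?ler_wpM2l ?mulr_ge0 ?invr_ge0 ?sqr_ge0.
have rk k : (k <= m)%N -> `|r k| <= k%:R * B.
  elim: k => [_|k IH km].
    by rewrite /r !mul0r scale0r addr0 expr0n/= mulr0 mul0r subrr !subr0 normr0.
  rewrite -natr1 mulrDl mul1r -(subrK (r k) (r k.+1)) addrC.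
  by apply: le_trans (ler_normD _ _) _; apply: lerD; [exact/IH/ltnW | exact: rS].
have := rk m (leqnn m); rewrite /r mu scale1r mul1r expr1n mulr1.
move=> /le_trans; apply; rewrite /B -/u.
have -> : m%:R * (C1 * (u * l) ^+ 2 + e1 + u * (l * (C2 * l ^+ 2 + e2)) +
    2^-1 * u ^+ 2 * (Q * l ^+ 2)) = (m%:R * u) * (C1 * l ^+ 2 * u
    + l * (C2 * l ^+ 2 + e2) + 2^-1 * u * (Q * l ^+ 2)) + m%:R * e1 by ring.
rewrite mu mul1r.
have : 0 <= u * (Q * l ^+ 2) by rewrite !mulr_ge0 ?sqr_ge0.
have -> : C2 * l ^+ 3 = l * (C2 * l ^+ 2) by ring.
by lra.
Qed.

(** Every direction occurs twice in the list, so a full set remains for second difference quotients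
    after one copy of i has been spent on a first one. *)
Lemma mem_rem_double (d : nat) (i j : 'I_d) :
  j \in rem i (enum 'I_d ++ enum 'I_d).
Proof.
have si : i \in enum 'I_d ++ enum 'I_d by rewrite mem_cat mem_enum.
have /permP/(_ (pred1 j)) := perm_to_rem si.
rewrite count_cat (count_uniq_mem j (enum_uniq _)) mem_enum inE /= => h.
by rewrite -has_pred1 has_count; move: h; case: (i == j); case: (count_mem j _).
Qed.

(** Feed [taylor2] with [avgs_diff], applied once to f and once to its quotients. The latter are
    Lipschitz with constant [2 L / (K eta)], so their mesh error is of order [L / K]. *)
Lemma avgs_taylor (R : realType) (d K m : nat) (eta L : R)
    (f : 'rV[R]_d -> R) (x : 'rV[R]_d) :
  (0 < K)%N -> (0 < m)%N -> 0 < eta -> 0 <= L -> lip L f ->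
  exists (p : 'I_d -> R) (H : 'M[R]_d),
    [/\ H \is symmetricmx,
        (forall i j, `|H i j| <= 2 * L / (K%:R * eta)) &
        forall h, `|avgs K eta (enum 'I_d ++ enum 'I_d) f (x + h)
            - avgs K eta (enum 'I_d ++ enum 'I_d) f x
            - \sum_i h 0 i * p i - 2^-1 * quadform H h|
          <= 8 * L / (K%:R * eta) ^+ 2 * l1norm h ^+ 3
             + d%:R * (4 * L / K%:R) * l1norm h
             + 6 * L / (K%:R * eta) * l1norm h ^+ 2 / m%:R
             + m%:R * (d%:R * (2 * L * eta))].
Proof.
move=> K0 m0 eta0 L0 fL; have e0 : 0 < K%:R * eta :> R by rewrite mulr_gt0 ?ltr0n.
set s := enum _ ++ _; have sT i : i \in s by rewrite mem_cat mem_enum.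
set e := K%:R * eta in e0 *.
pose p i := avgs K eta (rem i s) (dquot e i f).
pose q i j := avgs K eta (rem j (rem i s)) (dquot e j (dquot e i f)).
have hq i j y : `|q i j y| <= 2 * L / e.
  by apply: avgs_bound => // z; apply/dquot_bound => //; exact: lip_dquot.
have hp i y h : `|p i (y + h) - p i y - \sum_j h 0 j * q i j y| <=
    8 * L / e ^+ 2 * l1norm h ^+ 2 + d%:R * (4 * L / K%:R).
  have := avgs_diff y h K0 eta0 (lip_dquot i e0 fL) (mem_rem_double i).
  rewrite -/e; have -> : 4 * (2 * L / e) / e = 8 * L / e ^+ 2.
    by field; rewrite gt_eqF.
  suff -> : 2 * (2 * L / e) * eta = 4 * L / K%:R by [].
  have KR0 : K%:R != 0 :> R by rewrite pnatr_eq0 -lt0n.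
  by rewrite /e; field; rewrite KR0 gt_eqF.
have hF y h := avgs_diff y h K0 eta0 fL sT.
(* The second quotients are symmetrized, since covariances are compared at symmetric matrices only;
   the quadratic form does not change. *)
exists (fun i => p i x), (\matrix_(i, j) (2^-1 * (q i j x + q j i x))); split.
- by apply/is_hermitianmxP; rewrite expr0 scale1r; apply/matrixP => i j;
    rewrite !mxE addrC.
- move=> i j; rewrite mxE normrM ger0_norm ?invr_ge0//.
  have := hq i j x; have := hq j i x; have := ler_normD (q i j x) (q j i x); lra.
move=> h; have -> : quadform (\matrix_(i, j) (2^-1 * (q i j x + q j i x))) h =
    \sum_i h 0 i * \sum_j h 0 j * q i j x.
  rewrite /quadform mxE.
  under eq_bigr do rewrite mxE mulr_suml.
  have -> : \sum_i h 0 i * (\sum_j h 0 j * q i j x) =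
     \sum_i \sum_j 2^-1 * (h 0 i * h 0 j * q i j x + h 0 i * h 0 j * q j i x).
    have S1 : \sum_i h 0 i * (\sum_j h 0 j * q i j x) =
        \sum_i \sum_j h 0 i * h 0 j * q i j x.
      by apply: eq_bigr => i _; rewrite mulr_sumr; apply: eq_bigr => j _; rewrite mulrA.
    have S2 : \sum_i \sum_j h 0 i * h 0 j * q i j x =
        \sum_i \sum_j h 0 i * h 0 j * q j i x.
      by rewrite exchange_big; apply: eq_bigr => i _; apply: eq_bigr => j _;
        rewrite (mulrC (h 0 i)).
    under [RHS]eq_bigr do rewrite -mulr_sumr big_split.
    rewrite -mulr_sumr big_split/= -S2 S1; by field.
  apply: eq_bigr => i _; apply: eq_bigr => j _; rewrite !mxE; ring.
have C0 : 0 <= 8 * L / e ^+ 2 by rewrite divr_ge0 ?exprn_ge0 ?(ltW e0)// mulr_ge0.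
have Q0 : 0 <= 2 * L / e by rewrite divr_ge0 ?(ltW e0)// mulr_ge0.
have := taylor2 x h m0 C0 Q0 hF hp hq.
suff -> : 4 * L / e + 2 * L / e = 6 * L / e by [].
ring.
Qed.

(** The order of the quantifiers is the point. C depends on the width eps = K eta but not on the
    mesh, and K serves all functions that are [lip L] at once, hence every intermediate function of
    a chain. First m is taken large for the error in 1/m, then K is taken large, depending on m, for
    the mesh errors. *)
Lemma smoothing (R : realType) (d : nat) (L eps : R) : 0 <= L -> 0 < eps ->
  exists C : R, 0 <= C /\ forall kappa : R, 0 < kappa ->
  exists K : nat, (0 < K)%N /\ forall (f : 'rV[R]_d -> R), lip L f -> forall x,
  exists (p : 'I_d -> R) (H : 'M[R]_d),
    [/\ H \is symmetricmx, fnorm H <= C &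
        forall h, `|avgs K (eps / K%:R) (enum 'I_d ++ enum 'I_d) f (x + h)
            - avgs K (eps / K%:R) (enum 'I_d ++ enum 'I_d) f x
            - \sum_i h 0 i * p i - 2^-1 * quadform H h|
          <= C * l1norm h ^+ 3 + kappa].
Proof.
move=> L0 eps0.
pose Q := 2 * L / eps; have Q0 : 0 <= Q by rewrite divr_ge0 ?(ltW eps0)// mulr_ge0.
pose D := Num.sqrt (\sum_(i < d) \sum_(j < d) Q ^+ 2).
pose C2 := 8 * L / eps ^+ 2.
have C20 : 0 <= C2 by rewrite divr_ge0 ?exprn_ge0 ?(ltW eps0)// mulr_ge0.
exists (D + C2 + 2); split; first by rewrite !addr_ge0// sqrtr_ge0.
(* Three error terms of size k add up to at most kappa; since k <= 1/3, their multiples of l^3 fit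
   into the summand 2 of the constant, once l and l^2 are bounded by 1 + l^3. *)
move=> kappa kappa0; pose k := Num.min kappa 1 / 3.
have k0 : 0 < k by rewrite divr_gt0// lt_min kappa0 ltr01.
have big_nat (A : R) : 0 <= A -> exists2 m : nat, (0 < m)%N & A / m%:R <= k.
  move=> A0; exists (Num.bound (A / k)).+1 => //.
  rewrite ler_pdivrMr ?ltr0n// mulrC -ler_pdivrMr//; apply/ltW.
  apply: lt_le_trans (archi_boundP _) _; first by rewrite divr_ge0// ltW.
  by rewrite ler_nat.
have [m m0 hm] : exists2 m : nat, (0 < m)%N & (6 * L / eps) / m%:R <= k.
  by apply: big_nat; rewrite divr_ge0 ?(ltW eps0)// mulr_ge0.
have [K K0 hK] : exists2 K : nat, (0 < K)%N &
    (d%:R * (4 * L) + m%:R * (d%:R * (2 * L * eps))) / K%:R <= k.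
  by apply: big_nat; rewrite addr_ge0 ?mulr_ge0// ltW.
have KR : 0 < K%:R :> R by rewrite ltr0n.
have KR0 : K%:R != 0 :> R by rewrite gt_eqF.
exists K; split => // f fL x.
have eta0 : 0 < eps / K%:R by rewrite divr_gt0.
have Keta : K%:R * (eps / K%:R) = eps by rewrite mulrC mulfVK.
have [p [H [Hs HQ Hh]]] := avgs_taylor x K0 m0 eta0 L0 fL.
rewrite Keta in HQ Hh; exists p, H; split => //.
  rewrite -addrA (le_trans _ (ler_wpDr _ (lexx D)))//; last by rewrite addr_ge0.
  rewrite ler_wsqrtr//; apply: ler_sum => i _; apply: ler_sum => j _.
  by rewrite -[H i j ^+ 2]real_normK ?num_real// ler_pXn2r ?nnegrE.
move=> h; apply: le_trans (Hh h) _; have l0 := l1norm_ge0 h.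
set l := l1norm h in l0 *.
have l3 : l ^+ 2 <= 1 + l ^+ 3.
  have [l1|/ltW l1] := leP l 1.
    by rewrite ler_wpDr ?exprn_ge0// exprn_ile1.
  by rewrite ler_wpDl// exprS ler_peMl// sqr_ge0.
have l1 : l <= 1 + l ^+ 3.
  have [l1|/ltW l1] := leP l 1; first by rewrite ler_wpDr ?exprn_ge0.
  by rewrite ler_wpDl// exprS ler_peMr// exprn_ege1.
pose A1 := d%:R * (4 * L) / K%:R; pose A2 := m%:R * (d%:R * (2 * L * eps)) / K%:R.
have A10 : 0 <= A1 by rewrite divr_ge0 ?mulr_ge0 ?(ltW KR) ?(ltW eps0).
have A20 : 0 <= A2 by rewrite divr_ge0 ?mulr_ge0 ?(ltW KR) ?(ltW eps0).
have A12 : A1 + A2 <= k by rewrite /A1 /A2 -mulrDl.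
have -> : d%:R * (4 * L / K%:R) * l = A1 * l by rewrite /A1 !mulrA.
have -> : m%:R * (d%:R * (2 * L * (eps / K%:R))) = A2 by rewrite /A2 !mulrA.
have -> : 6 * L / eps * l ^+ 2 / m%:R = 6 * L / eps / m%:R * l ^+ 2 by rewrite mulrAC.
have l30 : 0 <= l ^+ 3 by rewrite exprn_ge0.
have B1 : A1 * l <= k * (1 + l ^+ 3) by apply: ler_pM => //; lra.
have B2 : 6 * L / eps / m%:R * l ^+ 2 <= k * (1 + l ^+ 3).
  by apply: ler_pM => //; rewrite ?sqr_ge0// !divr_ge0 ?(ltW eps0)// mulr_ge0.
have k1 : k <= 1 / 3 by rewrite /k ler_pM2r// ge_min lexx orbT.
have kk : k <= kappa / 3 by rewrite /k ler_pM2r// ge_min lexx.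
have B3 : k * l ^+ 3 <= 1 / 3 * l ^+ 3 by rewrite ler_wpM2r.
have D0 : 0 <= D * l ^+ 3 by rewrite mulr_ge0// sqrtr_ge0.
rewrite -/C2; lra.
Qed.

(** * Euclidean norm and classes of test functions *)

Lemma enorm_ge0 (R : realType) (d : nat) (x : 'rV[R]_d) : 0 <= enorm x.
Proof. exact: sqrtr_ge0. Qed.

Lemma coord_enorm (R : realType) (d : nat) (x : 'rV[R]_d) (i : 'I_d) :
  `|x 0 i| <= enorm x.
Proof.
rewrite -sqrtr_sqr ler_wsqrtr// (bigD1 i)//= ler_wpDr//.
by apply: sumr_ge0 => j _; exact: sqr_ge0.
Qed.

Lemma l1norm_le_enorm (R : realType) (d : nat) (x : 'rV[R]_d) :
  l1norm x <= d%:R * enorm x.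
Proof. by apply: sum_le_const => i; exact: coord_enorm. Qed.

Lemma enorm_le_l1norm (R : realType) (d : nat) (x : 'rV[R]_d) :
  enorm x <= l1norm x.
Proof.
rewrite -(ger0_norm (l1norm_ge0 x)) -sqrtr_sqr ler_wsqrtr// expr2.
rewrite {1}/l1norm mulr_suml; apply: ler_sum => i _.
rewrite -[x 0 i ^+ 2]real_normK ?num_real// expr2 ler_wpM2l//.
by rewrite /l1norm (bigD1 i)//= ler_wpDr// sumr_ge0.
Qed.

Lemma enorm_sqr (R : realType) (d : nat) (x : 'rV[R]_d) :
  enorm x ^+ 2 = \sum_i x 0 i ^+ 2.
Proof. by rewrite sqr_sqrtr// sumr_ge0// => i _; exact: sqr_ge0. Qed.

(** Multiply by a + b: the difference of squares is a sum over the coordinates, in which each factor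
    x_i + (x + h)_i is at most a + b in absolute value. This puts [enorm (Y w)] in the space of
    random variables. *)
Lemma lip_enorm (R : realType) (d : nat) : lip 1 (@enorm R d).
Proof.
move=> x h; rewrite mul1r; set a := enorm (x + h); set b := enorm x.
have a0 : 0 <= a := enorm_ge0 _; have b0 : 0 <= b := enorm_ge0 _.
have [ab0|ab0] := eqVneq (a + b) 0.
  have -> : a - b = 0 by lra.
  by rewrite normr0 l1norm_ge0.
have {ab0} ab : 0 < a + b by rewrite lt_neqAle eq_sym ab0 addr_ge0.
rewrite -(ler_pM2r ab) -{1}(gtr0_norm ab) -normrM -subr_sqr !enorm_sqr -sumrB.
apply: le_trans (ler_norm_sum _ _ _) _.
rewrite /l1norm mulr_suml; apply: ler_sum => i _.
rewrite subr_sqr normrM; apply: ler_pM => //.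
  by rewrite mxE addrAC subrr add0r.
by apply: le_trans (ler_normD _ _) _; apply: lerD; exact: coord_enorm.
Qed.

Lemma lip_C_lLip (R : realType) (d : nat) (L : R) (f : 'rV[R]_d -> R) :
  lip L f -> C_lLip f.
Proof.
(* The summand 1 keeps the constant positive when L = 0 or d = 0. *)
move=> fL; exists (`|L| * d%:R + 1), 0%N; split.
  by rewrite ltr_wpDl// mulr_ge0.
move=> x y; have := fL y (x - y); rewrite [y + _]addrC subrK => /le_trans; apply.
rewrite !expr0; have e0 := enorm_ge0 (x - y).
apply: le_trans (ler_wpM2r (l1norm_ge0 _) (ler_norm L)) _.
apply: le_trans (ler_wpM2l (normr_ge0 L) (l1norm_le_enorm _)) _.
rewrite mulrA ler_wpM2r//.
have : 0 <= `|L| * d%:R by rewrite mulr_ge0.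
lra.
Qed.

Lemma C_bLip_lip (R : realType) (d : nat) (f : 'rV[R]_d -> R) :
  C_bLip f -> exists2 L : R, 0 <= L & lip L f.
Proof.
move=> [_ [L fL]]; exists `|L| => // x h.
have := fL (x + h) x; rewrite addrAC subrr add0r => /le_trans; apply.
apply: le_trans (ler_wpM2r (enorm_ge0 _) (ler_norm L)) _.
by rewrite ler_wpM2l// enorm_le_l1norm.
Qed.

Lemma lip_C_bLip (R : realType) (d : nat) (L B : R) (f : 'rV[R]_d -> R) :
  lip L f -> (forall x, `|f x| <= B) -> C_bLip f.
Proof.
move=> fL fB; split; first by exists B.
exists (`|L| * d%:R) => x y.
have := fL y (x - y); rewrite [y + _]addrC subrK => /le_trans; apply.
apply: le_trans (ler_wpM2r (l1norm_ge0 _) (ler_norm L)) _.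
by rewrite -mulrA ler_wpM2l// l1norm_le_enorm.
Qed.

(** * Closure properties of [rvs] and calculus of the sublinear expectation *)

Lemma rvs_sum (R : realType) (Omega : Type) (S : sublinear_space R Omega)
    (I : Type) (r : seq I) (X : I -> Omega -> R) :
  (forall i, rvs S (X i)) -> rvs S (fun w => \sum_(i <- r) X i w).
Proof.
move=> rX; elim: r => [|i r IH].
  by under eq_fun do rewrite big_nil; exact: rvs_cst.
by under eq_fun do rewrite big_cons; exact: rvs_add.
Qed.

Lemma rvs_lip (R : realType) (Omega : Type) (S : sublinear_space R Omega)
    (d : nat) (L : R) (Y : Omega -> 'rV[R]_d) (f : 'rV[R]_d -> R) :
  random_vector S Y -> lip L f -> rvs S (fun w => f (Y w)).
Proof. by move=> rY fL; apply: rvs_comp => //; exact: lip_C_lLip fL. Qed.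

Lemma random_vector_affine (R : realType) (Omega : Type)
    (S : sublinear_space R Omega) (d : nat) (x : 'rV[R]_d) (c : R)
    (Y : Omega -> 'rV[R]_d) :
  random_vector S Y -> random_vector S (fun w => x + c *: Y w).
Proof.
move=> rY i; under eq_fun do rewrite !mxE.
by apply: rvs_add; [exact: rvs_cst | exact: rvs_scale].
Qed.

Lemma rvs_sqr (R : realType) (Omega : Type) (S : sublinear_space R Omega)
    (X : Omega -> R) : rvs S X -> rvs S (fun w => X w ^+ 2).
Proof.
move=> rX; pose f (v : 'rV[R]_1) := v 0 0 ^+ 2.
have -> : (fun w => X w ^+ 2) = (fun w => f (\row_(j < 1) X w)).
  by apply/funext => w; rewrite /f mxE.
apply: rvs_comp.
  by move=> i; under eq_fun do rewrite mxE.
exists 1, 1%N; split => // x y; rewrite mul1r !expr1 /f subr_sqr normrM mulrC.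
have hx := coord_enorm x 0; have hy := coord_enorm y 0.
apply: ler_pM => //; last by have := coord_enorm (x - y) 0; rewrite !mxE.
by have := ler_normD (x 0 0) (y 0 0); lra.
Qed.

(** Polarization reduces products to squares. *)
Lemma rvs_mul (R : realType) (Omega : Type) (S : sublinear_space R Omega)
    (X Y : Omega -> R) : rvs S X -> rvs S Y -> rvs S (fun w => X w * Y w).
Proof.
move=> rX rY.
have -> : (fun w => X w * Y w) = (fun w => 2^-1 * (X w + Y w) ^+ 2 +
    ((- 2^-1) * X w ^+ 2 + (- 2^-1) * Y w ^+ 2)).
  by apply/funext => w; field.
apply: rvs_add; first by apply/rvs_scale/rvs_sqr; exact: rvs_add.
by apply: rvs_add; apply/rvs_scale/rvs_sqr.
Qed.

Lemma rvs_cube (R : realType) (Omega : Type) (S : sublinear_space R Omega)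
    (X : Omega -> R) : rvs S X -> rvs S (fun w => X w ^+ 3).
Proof.
move=> rX; under eq_fun do rewrite exprS.
by apply: rvs_mul => //; exact: rvs_sqr.
Qed.

Lemma rvs_l1norm (R : realType) (Omega : Type) (S : sublinear_space R Omega)
    (d : nat) (Y : Omega -> 'rV[R]_d) :
  random_vector S Y -> rvs S (fun w => l1norm (Y w)).
Proof. by move=> rY; apply: rvs_sum => i; exact: rvs_abs. Qed.

Lemma rvs_quadform (R : realType) (Omega : Type) (S : sublinear_space R Omega)
    (d : nat) (H : 'M[R]_d) (Y : Omega -> 'rV[R]_d) :
  random_vector S Y -> rvs S (fun w => quadform H (Y w)).
Proof.
move=> rY; under eq_fun do rewrite /quadform mxE.
apply: rvs_sum => j; under eq_fun do rewrite !mxE.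
apply: rvs_mul => //; apply: rvs_sum => k.
by under eq_fun do rewrite mulrC; exact: rvs_scale.
Qed.

Lemma expect_leD (R : realType) (Omega : Type) (S : sublinear_space R Omega)
    (X Y Z : Omega -> R) : rvs S X -> rvs S Y -> rvs S Z ->
  (forall w, X w <= Y w + Z w) -> expect S X <= expect S Y + expect S Z.
Proof.
move=> rX rY rZ XYZ; apply: le_trans (expect_subadd rY rZ).
by apply: expect_mono => //; exact: rvs_add.
Qed.

Lemma expect_le_addc (R : realType) (Omega : Type) (S : sublinear_space R Omega)
    (X Y : Omega -> R) (c : R) : rvs S X -> rvs S Y ->
  (forall w, X w <= Y w + c) -> expect S X <= expect S Y + c.
Proof.
move=> rX rY XY; rewrite -[X in _ + X](expect_cst S).
by apply: expect_leD => //; exact: rvs_cst.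
Qed.

Lemma expect_addc (R : realType) (Omega : Type) (S : sublinear_space R Omega)
    (X : Omega -> R) (c : R) : rvs S X ->
  expect S (fun w => X w + c) = expect S X + c.
Proof.
move=> rX; have rXc := rvs_add rX (rvs_cst S c).
apply/eqP; rewrite eq_le expect_le_addc//= -lerBrDr.
by apply: expect_le_addc => // w; lra.
Qed.

Lemma expect_dist (R : realType) (Omega : Type) (S : sublinear_space R Omega)
    (X Y : Omega -> R) (c : R) : rvs S X -> rvs S Y ->
  (forall w, `|X w - Y w| <= c) -> `|expect S X - expect S Y| <= c.
Proof.
move=> rX rY XY; rewrite ler_distlC; apply/andP; split.
  rewrite lerBlDr; apply: expect_le_addc => // w.
  by have := XY w; rewrite ler_distl => /andP[]; lra.
apply: expect_le_addc => // w.
by have := XY w; rewrite ler_distl => /andP[]; lra.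
Qed.

Lemma expect_sum_le (R : realType) (Omega : Type) (S : sublinear_space R Omega)
    (I : Type) (r : seq I) (X : I -> Omega -> R) :
  (forall i, rvs S (X i)) ->
  expect S (fun w => \sum_(i <- r) X i w) <= \sum_(i <- r) expect S (X i).
Proof.
move=> rX; elim: r => [|i r IH].
  by under eq_fun do rewrite big_nil; rewrite expect_cst big_nil.
rewrite big_cons; apply: le_trans (lerD (lexx _) IH).
by apply: expect_leD => //; [exact: rvs_sum|exact: rvs_sum|move=> w; rewrite big_cons].
Qed.

(** * One-step operators and the comparison of their products *)

Definition step (R : realType) (Omega : Type) (S : sublinear_space R Omega)
    (d : nat) (c : R) (Y : Omega -> 'rV[R]_d) (f : 'rV[R]_d -> R)
    (x : 'rV[R]_d) : R :=
  expect S (fun w => f (x + c *: Y w)).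

(** The head of [s] is the outermost operator: the last variable is integrated first, as
    independence of each variable from its past requires. *)
Definition chain (R : realType) (Omega : Type) (S : sublinear_space R Omega)
    (d : nat) (c : R) (Y : nat -> Omega -> 'rV[R]_d) (s : seq nat)
    (f : 'rV[R]_d -> R) : 'rV[R]_d -> R :=
  foldr (fun k => step S c (Y k)) f s.

Definition centered (R : realType) (Omega : Type) (S : sublinear_space R Omega)
    (d : nat) (M : R) (Y : Omega -> 'rV[R]_d) : Prop :=
  [/\ random_vector S Y,
      (forall j, expect S (fun w => Y w 0 j) = 0 /\
                 expect S (fun w => - Y w 0 j) = 0) &
      expect S (fun w => l1norm (Y w) ^+ 3) <= M].

Lemma lip_step (R : realType) (Omega : Type) (S : sublinear_space R Omega)
    (d : nat) (c L : R) (Y : Omega -> 'rV[R]_d) (f : 'rV[R]_d -> R) :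
  random_vector S Y -> lip L f -> lip L (step S c Y f).
Proof.
move=> rY fL x h; apply: expect_dist.
- exact: rvs_lip (random_vector_affine _ _ rY) fL.
- exact: rvs_lip (random_vector_affine _ _ rY) fL.
- by move=> w; rewrite addrAC; exact: fL.
Qed.

Lemma step_bound (R : realType) (Omega : Type) (S : sublinear_space R Omega)
    (d : nat) (c L B : R) (Y : Omega -> 'rV[R]_d) (f : 'rV[R]_d -> R) :
  random_vector S Y -> lip L f -> (forall x, `|f x| <= B) ->
  forall x, `|step S c Y f x| <= B.
Proof.
move=> rY fL fB x; rewrite -[step _ _ _ _ _]subr0 -[X in _ - X](expect_cst S 0).
apply: expect_dist; last by move=> w; rewrite subr0.
- exact: rvs_lip (random_vector_affine _ _ rY) fL.
- exact: rvs_cst.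
Qed.

Lemma step_le_addc (R : realType) (Omega : Type) (S : sublinear_space R Omega)
    (d : nat) (c L e : R) (Y : Omega -> 'rV[R]_d) (f g : 'rV[R]_d -> R) :
  random_vector S Y -> lip L f -> lip L g -> (forall x, f x <= g x + e) ->
  forall x, step S c Y f x <= step S c Y g x + e.
Proof.
move=> rY fL gL fg x; apply: expect_le_addc => //.
- exact: rvs_lip (random_vector_affine _ _ rY) fL.
- exact: rvs_lip (random_vector_affine _ _ rY) gL.
Qed.

Lemma lip_chain (R : realType) (Omega : Type) (S : sublinear_space R Omega)
    (d : nat) (c L : R) (Y : nat -> Omega -> 'rV[R]_d) (s : seq nat)
    (f : 'rV[R]_d -> R) :
  (forall k, random_vector S (Y k)) -> lip L f -> lip L (chain S c Y s f).
Proof. by move=> rY fL; elim: s => //= k s IH; exact: lip_step. Qed.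

(** A Jensen inequality from sub-additivity, combined with translation invariance. Being one-sided,
    it forces the two bounds of the limit theorem to be proved separately. *)
Lemma step_avg (R : realType) (Omega : Type) (S : sublinear_space R Omega)
    (d : nat) (c L : R) (Y : Omega -> 'rV[R]_d) (K : nat) (eta : R) (i : 'I_d)
    (f : 'rV[R]_d -> R) (x : 'rV[R]_d) :
  random_vector S Y -> lip L f ->
  step S c Y (avg K eta i f) x <= avg K eta i (step S c Y f) x.
Proof.
move=> rY fL; have rf (j : 'I_K) :
    rvs S (fun w => f (x + c *: Y w + (j%:R * eta) *: delta_mx 0 i)).
  under eq_fun do rewrite addrAC.
  exact: rvs_lip (random_vector_affine _ _ rY) fL.
rewrite /step expect_poshom ?invr_ge0//; last exact: rvs_sum.
rewrite ler_wpM2l ?invr_ge0//; apply: le_trans (expect_sum_le _ rf) _.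
by apply: ler_sum => j _; under eq_fun do rewrite addrAC.
Qed.

Lemma step_avgs (R : realType) (Omega : Type) (S : sublinear_space R Omega)
    (d : nat) (c L : R) (Y : Omega -> 'rV[R]_d) (K : nat) (eta : R)
    (s : seq 'I_d) (f : 'rV[R]_d -> R) (x : 'rV[R]_d) : (0 < K)%N ->
  random_vector S Y -> lip L f ->
  step S c Y (avgs K eta s f) x <= avgs K eta s (step S c Y f) x.
Proof.
move=> K0 rY fL; elim: s x => //= i s IH x.
apply: le_trans (step_avg _ _ _ _ _ rY (lip_avgs eta s K0 fL)) _.
by rewrite ler_wpM2l ?invr_ge0//; apply: ler_sum => j _; exact: IH.
Qed.

(** Split by sub-additivity; the sign of p i decides which of the two mean conditions is used. The
    upper bound suffices, because it can be applied to p and to -p. *)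
Lemma expect_linear_le0 (R : realType) (Omega : Type)
    (S : sublinear_space R Omega) (d : nat) (M : R) (Y : Omega -> 'rV[R]_d)
    (p : 'I_d -> R) :
  centered S M Y -> expect S (fun w => \sum_i p i * Y w 0 i) <= 0.
Proof.
move=> [rY mY _]; apply: le_trans (expect_sum_le _ _) _.
  by move=> i; exact: rvs_scale.
apply: sumr_le0 => i _; have [Y0 NY0] := mY i.
have [p0|/ltW p0] := leP 0 (p i); first by rewrite expect_poshom// Y0 mulr0.
have -> : (fun w => p i * Y w 0 i) = (fun w => - p i * - Y w 0 i).
  by apply/funext => w; rewrite mulrNN.
rewrite expect_poshom ?oppr_ge0// ?NY0 ?mulr0//.
by under eq_fun do rewrite -mulN1r; exact: rvs_scale.
Qed.

Lemma step_taylor (R : realType) (Omega : Type) (S : sublinear_space R Omega)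
    (d : nat) (c L M C kappa : R) (Y : Omega -> 'rV[R]_d) (F : 'rV[R]_d -> R)
    (x : 'rV[R]_d) (p : 'I_d -> R) (H : 'M[R]_d) :
  centered S M Y -> lip L F -> 0 <= c -> 0 <= C ->
  (forall h, `|F (x + h) - F x - \sum_i h 0 i * p i - 2^-1 * quadform H h|
     <= C * l1norm h ^+ 3 + kappa) ->
  `|step S c Y F x
    - (F x + c ^+ 2 * (2^-1 * expect S (fun w => quadform H (Y w))))|
  <= C * c ^+ 3 * M + kappa.
Proof.
move=> cY FL c0 C0 hF; have [rY _ MY] := cY.
have rF : rvs S (fun w => F (x + c *: Y w)).
  exact: rvs_lip (random_vector_affine _ _ rY) FL.
have rq := rvs_quadform H rY.
have rl := rvs_cube (rvs_l1norm rY).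
have rlin (t : R) : rvs S (fun w => \sum_i (t * p i) * Y w 0 i).
  by apply: rvs_sum => i; exact: rvs_scale.
(* The linear term and the cubic error together. With t = c this bounds the increment of F from
   above by [Q], with t = -c it bounds [Q] from above by the increment; each time the expectation of
   [E t] is controlled by [EE]. *)
pose E (t : R) w := \sum_i (t * p i) * Y w 0 i + C * c ^+ 3 * l1norm (Y w) ^+ 3.
have rE t : rvs S (E t) by apply: rvs_add => //; exact: rvs_scale.
have EE t : expect S (E t) <= C * c ^+ 3 * M.
  apply: le_trans (expect_subadd (rlin t) (rvs_scale _ rl)) _.
  rewrite -[leRHS]add0r; apply: lerD; first exact: expect_linear_le0 cY.
  by rewrite expect_poshom ?mulr_ge0 ?exprn_ge0// ler_wpM2l ?mulr_ge0 ?exprn_ge0.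
pose Q w := c ^+ 2 * 2^-1 * quadform H (Y w).
have rQ : rvs S Q by exact: rvs_scale.
have EQ : expect S Q = c ^+ 2 * (2^-1 * expect S (fun w => quadform H (Y w))).
  by rewrite expect_poshom ?mulr_ge0 ?invr_ge0 ?sqr_ge0// mulrA.
have key w : `|F (x + c *: Y w) - F x - \sum_i (c * p i) * Y w 0 i - Q w|
    <= C * c ^+ 3 * l1norm (Y w) ^+ 3 + kappa.
  have := hF (c *: Y w); rewrite l1norm_scale (ger0_norm c0) exprMn mulrA.
  have -> : \sum_i (c *: Y w) 0 i * p i = \sum_i c * p i * Y w 0 i.
    by apply: eq_bigr => i _; rewrite mxE mulrAC.
  suff -> : 2^-1 * quadform H (c *: Y w) = Q w by [].
  rewrite /Q /quadform linearZ /= -scalemxAr -!scalemxAl 2!mxE.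
  by rewrite mulrA mulrCA mulrC; ring.
rewrite -EQ ler_distl; apply/andP; split.
  have : expect S Q <= (expect S (fun w => F (x + c *: Y w)) + (kappa - F x))
      + C * c ^+ 3 * M.
    apply: (le_trans _ (lerD (lexx _) (EE (-1 * c)))).
    rewrite -addrA (addrC (kappa - F x)) addrA.
    apply: (le_trans _ (lerD (expect_subadd rF (rE _)) (lexx _))).
    apply: expect_le_addc => //; first exact: rvs_add.
    move=> w; have := key w; rewrite ler_norml /E => /andP[].
    have -> : \sum_i (-1 * c * p i) * Y w 0 i = - \sum_i (c * p i) * Y w 0 i.
      by rewrite -sumrN; apply: eq_bigr => i _; rewrite mulN1r !mulNr.
    lra.
  rewrite /step; lra.
apply: le_trans (_ : _ <= expect S Q + C * c ^+ 3 * M + (kappa + F x)) _; last lra.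
apply: le_trans (_ : _ <= expect S Q + expect S (E c) + (kappa + F x)) _; last first.
  by rewrite lerD2r lerD2l.
apply: (le_trans _ (lerD (expect_subadd rQ (rE _)) (lexx _))).
apply: expect_le_addc => //; first exact: rvs_add.
by move=> w; have := key w; rewrite ler_norml /E => /andP[]; lra.
Qed.

Lemma chain_le_addc (R : realType) (Omega : Type)
    (S : sublinear_space R Omega) (d : nat) (c L e : R)
    (Y : nat -> Omega -> 'rV[R]_d) (s : seq nat) (f g : 'rV[R]_d -> R) :
  (forall k, random_vector S (Y k)) -> lip L f -> lip L g ->
  (forall x, f x <= g x + e) ->
  forall x, chain S c Y s f x <= chain S c Y s g x + e.
Proof.
move=> rY fL gL fg; elim: s => //= k s IH x.
exact: step_le_addc (rY k) (lip_chain _ _ rY fL) (lip_chain _ _ rY gL) IH x.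
Qed.

(** With g the chain built so far and W the average, one step reads B (W g) <= A (W g) + err <= W (A
    g) + err. The function A g is again [lip L], so the induction goes on with the same
    constants. *)
Lemma chain_avgs_le (R : realType) (d : nat) (c L : R)
    (Omega1 : Type) (S1 : sublinear_space R Omega1)
    (Y1 : nat -> Omega1 -> 'rV[R]_d)
    (Omega2 : Type) (S2 : sublinear_space R Omega2)
    (Y2 : nat -> Omega2 -> 'rV[R]_d)
    (K : nat) (eta : R) (r : seq 'I_d) (err : nat -> R) (s : seq nat)
    (f : 'rV[R]_d -> R) (x : 'rV[R]_d) : (0 < K)%N -> lip L f ->
  (forall k, random_vector S1 (Y1 k)) -> (forall k, random_vector S2 (Y2 k)) ->
  (forall k g y, lip L g -> step S2 c (Y2 k) (avgs K eta r g) y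
     <= step S1 c (Y1 k) (avgs K eta r g) y + err k) ->
  chain S2 c Y2 s (avgs K eta r f) x
  <= avgs K eta r (chain S1 c Y1 s f) x + \sum_(k <- s) err k.
Proof.
move=> K0 fL rY1 rY2 hstep; elim: s x => [|k s IH] x /=; first by rewrite big_nil addr0.
have gL := lip_chain c s rY1 fL; rewrite big_cons.
have h1 := step_le_addc c (rY2 k) (lip_chain c s rY2 (lip_avgs eta r K0 fL))
  (lip_avgs eta r K0 gL) IH x.
have h2 := hstep k _ x gL.
have h3 := step_avgs c eta r x K0 (rY1 k) gL.
lra.
Qed.

(** W consists of 2 d averages, each moving a function by at most [L eps]. Smoothing is paid for at
    both ends of the chain, whence [4 d L eps]. The constant C is fixed before f, c and s. *)
Lemma chain_le (R : realType) (d : nat) (L M1 M2 eps : R)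
    (Omega1 : Type) (S1 : sublinear_space R Omega1)
    (Y1 : nat -> Omega1 -> 'rV[R]_d)
    (Omega2 : Type) (S2 : sublinear_space R Omega2)
    (Y2 : nat -> Omega2 -> 'rV[R]_d) (a : nat -> R) :
  0 <= L -> 0 < eps ->
  (forall k, centered S1 M1 (Y1 k)) -> (forall k, centered S2 M2 (Y2 k)) ->
  (forall k, 0 <= a k) ->
  (forall k (H : 'M[R]_d), H \is symmetricmx ->
     `|2^-1 * expect S1 (fun w => quadform H (Y1 k w))
       - 2^-1 * expect S2 (fun w => quadform H (Y2 k w))| <= a k * fnorm H) ->
  exists2 C : R, 0 <= C & forall (f : 'rV[R]_d -> R) c s x, lip L f -> 0 <= c ->
    chain S2 c Y2 s f x <= chain S1 c Y1 s f x + d%:R * 4 * L * eps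
      + C * \sum_(k <- s) (c ^+ 2 * a k + c ^+ 3 * (M1 + M2)).
Proof.
move=> L0 eps0 cY1 cY2 a0 hG; have [C [C0 hC]] := smoothing d L0 eps0.
have rY1 k : random_vector S1 (Y1 k) by case: (cY1 k).
have rY2 k : random_vector S2 (Y2 k) by case: (cY2 k).
exists C => // f c s x fL c0; apply/ler_addgt0Pr => e e0.
(* Each step uses two expansions, so the mesh errors add up to [2 kappa] times the length of s. As C
   does not depend on kappa, the total can be kept below any e > 0. *)
pose kappa := e / ((size s)%:R * 2 + 1).
have s0 : 0 < (size s)%:R * 2 + 1 :> R by rewrite ltr_wpDl// mulr_ge0.
have kappa0 : 0 < kappa by rewrite divr_gt0.
have [K [K0 hK]] := hC _ kappa0.
set r := enum 'I_d ++ enum 'I_d in hK; pose eta := eps / K%:R.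
have KR : 0 < K%:R :> R by rewrite ltr0n.
have eta0 : 0 <= eta by rewrite divr_ge0 ?ltW.
have Keta : K%:R * eta = eps by rewrite mulrC mulfVK// gt_eqF.
have sz : (size r)%:R = d%:R * 2 :> R.
  by rewrite size_cat size_enum_ord natrD; ring.
pose err k := C * (c ^+ 2 * a k + c ^+ 3 * (M1 + M2)) + kappa * 2.
have hstep k g y : lip L g -> step S2 c (Y2 k) (avgs K eta r g) y
    <= step S1 c (Y1 k) (avgs K eta r g) y + err k.
  move=> gL; have [p [H [Hs HC hF]]] := hK g gL y.
  have FL := lip_avgs eta r K0 gL.
  have := step_taylor (cY1 k) FL c0 C0 hF; have := step_taylor (cY2 k) FL c0 C0 hF.
  have : c ^+ 2 * `|2^-1 * expect S1 (fun w => quadform H (Y1 k w))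
       - 2^-1 * expect S2 (fun w => quadform H (Y2 k w))| <= c ^+ 2 * (a k * C).
    rewrite ler_wpM2l ?sqr_ge0//; apply: le_trans (hG k H Hs) _.
    by rewrite ler_wpM2l.
  rewrite -{1}(ger0_norm (sqr_ge0 c)) -normrM !ler_norml.
  move=> /andP[? ?] /andP[? ?] /andP[? ?]; rewrite /err; lra.
have h1 := chain_avgs_le s x K0 fL rY1 rY2 hstep.
have h2 : chain S2 c Y2 s f x <=
    chain S2 c Y2 s (avgs K eta r f) x + d%:R * 2 * L * eps.
  have near y : f y <= avgs K eta r f y + d%:R * 2 * L * eps.
    have := avgs_near r y K0 eta0 fL; rewrite sz Keta ler_distl => /andP[+ _].
    lra.
  exact: chain_le_addc rY2 fL (lip_avgs eta r K0 fL) near x.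
have h3 := avgs_near r x K0 eta0 (lip_chain c s rY1 fL).
rewrite sz Keta ler_distl in h3; case/andP: h3 => _ h3.
have h4 : \sum_(k <- s) err k =
    C * \sum_(k <- s) (c ^+ 2 * a k + c ^+ 3 * (M1 + M2)) + (size s)%:R * 2 * kappa.
  rewrite big_split/= -mulr_sumr; congr (_ + _).
  by rewrite big_const_seq count_predT iter_addr_0 -mulr_natl; ring.
have h5 : (size s)%:R * 2 * kappa <= e.
  by rewrite /kappa mulrCA ler_piMr ?(ltW e0)// ler_pdivrMr// mul1r; lra.
lra.
Qed.

(** * Independent sums and the normal law as products of operators *)

Lemma coord_l1norm (R : realType) (d : nat) (x : 'rV[R]_d) (i : 'I_d) :
  `|x 0 i| <= l1norm x.
Proof. by rewrite /l1norm (bigD1 i)//= ler_wpDr// sumr_ge0. Qed.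

Lemma l1norm_split (R : realType) (m n : nat) (z : 'rV[R]_(m + n)) :
  l1norm z = l1norm (lsubmx z) + l1norm (rsubmx z).
Proof.
by rewrite /l1norm big_split_ord; congr (_ + _); apply: eq_bigr => i _; rewrite mxE.
Qed.

Lemma l1normD (R : realType) (d : nat) (x y : 'rV[R]_d) :
  l1norm (x + y) <= l1norm x + l1norm y.
Proof.
by rewrite /l1norm -big_split; apply: ler_sum => i _; rewrite mxE ler_normD.
Qed.

(** Independence refers to the whole past, a vector of R^m, whereas f lives on R^d. The additive map
    g bridges the two: it is the scaled sum of the past for partial sums, and a scaling for the
    normal law. *)
Lemma independent_step (R : realType) (m d : nat) (Omega : Type)
    (S : sublinear_space R Omega) (X : Omega -> 'rV[R]_m)
    (Y : Omega -> 'rV[R]_d) (g : 'rV[R]_m -> 'rV[R]_d) (A b L : R)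
    (f : 'rV[R]_d -> R) :
  independent_from S Y X -> {morph g : x y / x + y} ->
  (forall x, l1norm (g x) <= A * l1norm x) -> 0 <= A -> 0 <= L -> lip L f ->
  expect S (fun w => f (g (X w) + b *: Y w)) =
  expect S (fun w => step S b Y f (g (X w))).
Proof.
move=> iY gD gA A0 L0 fL.
pose phi (z : 'rV[R]_(m + d)) := f (g (lsubmx z) + b *: rsubmx z).
have phiL : lip (L * (A + `|b|)) phi.
  move=> z h; rewrite /phi !linearD/= gD addrACA.
  apply: le_trans (fL _ _) _; rewrite -mulrA ler_wpM2l//.
  apply: le_trans (l1normD _ _) _; rewrite l1norm_scale mulrDl l1norm_split.
  apply: lerD; last by rewrite ler_wpM2l// ler_wpDl// l1norm_ge0.
  by apply: le_trans (gA _) _; rewrite ler_wpM2l// ler_wpDr// l1norm_ge0.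
have := iY phi (lip_C_lLip phiL); rewrite /phi.
under eq_fun do rewrite row_mxKl row_mxKr.
by under [in X in _ = X -> _]eq_fun do under eq_fun do rewrite row_mxKl row_mxKr.
Qed.

Lemma chain_recr (R : realType) (Omega : Type) (S : sublinear_space R Omega)
    (d : nat) (c : R) (Y : nat -> Omega -> 'rV[R]_d) (n : nat)
    (f : 'rV[R]_d -> R) :
  chain S c Y (iota 0 n.+1) f = chain S c Y (iota 0 n) (step S c (Y n) f).
Proof.
have -> : iota 0 n.+1 = rcons (iota 0 n) n by rewrite -cats1 -addn1 iotaD.
by rewrite /chain foldr_rcons.
Qed.

(** Induction on n with f varying: integrating out the last variable replaces f by its one-step
    image. The chain counts from 0, the sequence from 1. *)
Lemma expect_partial_sum (R : realType) (d : nat) (Omega : Type)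
    (S : sublinear_space R Omega) (X : nat -> Omega -> 'rV[R]_d)
    (n : nat) (c L : R) (f : 'rV[R]_d -> R) :
  (forall i, (1 <= i)%N -> random_vector S (X i)) ->
  (forall i, (1 <= i)%N -> independent_from S (X i.+1) (initial_vector X i)) ->
  0 <= L -> lip L f ->
  expect S (fun w => f (c *: \sum_(1 <= i < n.+1) X i w)) =
  chain S c (fun k => X k.+1) (iota 0 n) f 0.
Proof.
move=> rX iX L0; elim: n f => [|n IH] f fL.
  by under eq_fun do rewrite big_geq// scaler0; rewrite expect_cst.
rewrite chain_recr -(IH _ (lip_step c (rX n.+1 isT) fL)).
(* The first variable has an empty past, and the independence hypothesis starts with X_2; here the
   past sum is the constant 0. *)
case: n {IH} => [|n].
  under eq_fun do rewrite big_nat1.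
  under [in RHS]eq_fun do rewrite big_geq// scaler0.
  by rewrite expect_cst /step; under [in RHS]eq_fun do rewrite add0r.
pose g (z : 'rV[R]_(n.+1 * d)) := c *: \sum_(k < n.+1) row k (vec_mx z).
have gE w : c *: \sum_(1 <= i < n.+2) X i w = g (initial_vector X n.+1 w).
  rewrite /g mxvecK big_add1/= big_mkord; congr (_ *: _).
  by apply: eq_bigr => k _; apply/rowP => j; rewrite !mxE.
have gD : {morph g : x y / x + y}.
  move=> x y; rewrite /g -scalerDr -big_split/=; congr (_ *: _).
  by apply: eq_bigr => k _; rewrite !linearD.
have gA x : l1norm (g x) <= `|c| * (d%:R * n.+1%:R) * l1norm x.
  rewrite l1norm_scale -!mulrA ler_wpM2l//; apply: sum_le_const => j.
  rewrite summxE; apply: le_trans (ler_norm_sum _ _ _) _.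
  by apply: sum_le_const => k; rewrite !mxE coord_l1norm.
under eq_fun do rewrite big_nat_recr//= scalerDr gE.
under [in RHS]eq_fun do rewrite gE.
by apply: (independent_step _ (iX n.+1 isT) gD gA) fL; rewrite ?mulr_ge0.
Qed.

Lemma ident_dist_step (R : realType) (d : nat) (Omega : Type)
    (S : sublinear_space R Omega) (a b : R) (N : Omega -> 'rV[R]_d)
    (Nbar : Omega -> 'rV[R]_d) (L : R) (f : 'rV[R]_d -> R) (x : 'rV[R]_d) :
  random_vector S N -> independent_from S Nbar N -> 0 <= L -> lip L f ->
  expect S (fun w => f (x + (a *: N w + b *: Nbar w))) =
  step S a N (step S b Nbar f) x.
Proof.
move=> rN iN L0 fL.
have f'L : lip L (fun z => f (x + z)) by move=> z h; rewrite addrA; exact: fL.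
have gD : {morph *:%R a : x y / x + y :> 'rV[R]_d} by move=> y z; exact: scalerDr.
have gA (y : 'rV[R]_d) : l1norm (a *: y) <= `|a| * l1norm y by rewrite l1norm_scale.
rewrite (independent_step b iN gD gA (normr_ge0 a) L0 f'L) /step.
by under eq_fun do under eq_fun do rewrite addrA.
Qed.

(** Stability with the coefficients sqrt n c and c peels one operator off sqrt (n+1) c N.
    Boundedness of f is carried along because equality in law is tested on bounded functions. *)
Lemma G_normal_chain (R : realType) (d : nat) (Omega : Type)
    (S : sublinear_space R Omega) (N : Omega -> 'rV[R]_d) (n : nat)
    (c L B : R) (f : 'rV[R]_d -> R) (x : 'rV[R]_d) :
  G_normal S N -> 0 <= c -> 0 <= L -> lip L f -> (forall x, `|f x| <= B) ->
  step S (Num.sqrt n%:R * c) N f x = chain S c (fun=> N) (iota 0 n) f x.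
Proof.
move=> [rN [Nbar [[rNb idN iN] hN]]] c0 L0.
elim: n f x => [|n IH] f x fL fB.
  rewrite /step sqrtr0 mul0r /=.
  by under eq_fun do rewrite scale0r addr0; exact: expect_cst.
rewrite chain_recr.
rewrite -(IH _ _ (lip_step c rN fL) (step_bound c rN fL fB)).
have shiftb y t : C_bLip (fun z => f (y + t *: z)).
  apply: (@lip_C_bLip _ _ (L * `|t|) B) => [z h|z]; last exact: fB.
  by rewrite scalerDr addrA -mulrA -l1norm_scale; exact: fL.
have a0 : 0 <= Num.sqrt n%:R * c by rewrite mulr_ge0// sqrtr_ge0.
have := hN _ _ a0 c0 _ (shiftb x 1).
have -> : Num.sqrt ((Num.sqrt n%:R * c) ^+ 2 + c ^+ 2) = Num.sqrt n.+1%:R * c.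
  rewrite exprMn sqr_sqrtr// -[X in _ + X]mul1r -mulrDl natr1.
  by rewrite sqrtrM// sqrtr_sqr ger0_norm.
under eq_fun do rewrite scale1r.
under [in X in _ = X -> _]eq_fun do rewrite scale1r.
rewrite (ident_dist_step _ _ _ rN iN L0 fL) /step => <-.
(* In the inner operator [Nbar] is tested by one bounded Lipschitz function for each fixed value of
   [N], so it can be replaced by a variable with the same law. *)
congr (expect S _); apply/funext => w.
exact: idN _ (shiftb _ _).
Qed.

(** * Truncation and the mean of the normal law *)

Definition trunc (R : realType) (k t : R) : R := Num.max (- k) (Num.min k t).

Lemma trunc_lip (R : realType) (k s t : R) :
  `|trunc k s - trunc k t| <= `|s - t|.
Proof.
wlog st : s t / t <= s => [H|].
  by case/orP: (le_total t s) => /H//; rewrite distrC [leRHS]distrC.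
rewrite [leRHS]ger0_norm ?subr_ge0// ler_norml /trunc /Num.max /Num.min.
by case: (ltP k s) => ?; case: (ltP k t) => ?; case: (ltP (- k) k) => ?;
  case: (ltP (- k) s) => ?; case: (ltP (- k) t) => ?; apply/andP; split; lra.
Qed.

Lemma trunc_bound (R : realType) (k t : R) : 0 <= k -> `|trunc k t| <= k.
Proof.
move=> k0; rewrite ler_norml /trunc /Num.max /Num.min.
by case: (ltP k t) => ?; case: (ltP (- k)) => ?; apply/andP; split; lra.
Qed.

(** The error vanishes for |t| < k, and otherwise it is at most |t| <= t^2 / k. *)
Lemma trunc_near (R : realType) (k t : R) : 0 < k ->
  `|trunc k t - t| <= k^-1 * t ^+ 2.
Proof.
move=> k0; rewrite mulrC ler_pdivlMr//.
have t2 := sqr_ge0 t.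
have tk : `|trunc k t - t| <= `|t|.
  rewrite /trunc /Num.max /Num.min; have := ler_norm t; have := ler_norm (- t).
  rewrite normrN ler_norml.
  by case: (ltP k t) => ?; case: (ltP (- k)) => ? ? ?; apply/andP; split; lra.
have [kt|tk'] := leP k `|t|.
  rewrite -[t ^+ 2]real_normK ?num_real// expr2.
  by apply: ler_pM => //; exact: ltW.
suff -> : trunc k t = t by rewrite subrr normr0 mul0r.
move: tk'; rewrite ltr_norml /trunc => /andP[h1 h2].
by rewrite min_r ?(ltW h2)// max_r// ltW.
Qed.

(* Truncation extends the equality of laws, tested on bounded functions only, to
   linear functions. *)
Lemma trunc_moment (R : realType) (Omega : Type) (S : sublinear_space R Omega)
    (X : Omega -> R) (k : R) : 0 < k -> rvs S X -> rvs S (fun w => trunc k (X w)) ->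
  `|expect S (fun w => trunc k (X w)) - expect S X|
    <= k^-1 * expect S (fun w => X w ^+ 2).
Proof.
move=> k0 rX rT; have rX2 := rvs_sqr rX.
have k0' : 0 <= k^-1 by rewrite invr_ge0 ltW.
rewrite -(expect_poshom k0' rX2) ler_distl; apply/andP; split.
  rewrite lerBlDr; apply: expect_leD => //; first exact: rvs_scale.
  by move=> w; have := trunc_near (X w) k0; rewrite ler_distl => /andP[]; lra.
apply: expect_leD => //; first exact: rvs_scale.
by move=> w; have := trunc_near (X w) k0; rewrite ler_distl => /andP[]; lra.
Qed.

Lemma ident_dist_mean (R : realType) (d : nat)
    (Omega1 : Type) (S1 : sublinear_space R Omega1) (Y1 : Omega1 -> 'rV[R]_d)
    (Omega2 : Type) (S2 : sublinear_space R Omega2) (Y2 : Omega2 -> 'rV[R]_d)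
    (t : R) (j : 'I_d) :
  random_vector S1 Y1 -> random_vector S2 Y2 -> ident_dist S1 Y1 S2 Y2 ->
  expect S1 (fun w => t * Y1 w 0 j) = expect S2 (fun w => t * Y2 w 0 j).
Proof.
move=> r1 r2 id12; apply/eqP; rewrite -subr_eq0 -normr_le0; apply/ler_addgt0Pr => e e0.
set A := expect S1 (fun w => (t * Y1 w 0 j) ^+ 2).
set B := expect S2 (fun w => (t * Y2 w 0 j) ^+ 2).
(* The truncation errors are A/k and B/k; this level makes their sum at most e. *)
pose k := (`|A| + `|B|) / e + 1.
have k0 : 0 < k by rewrite ltr_wpDl// divr_ge0 ?(ltW e0)// addr_ge0.
pose g (v : 'rV[R]_d) := trunc k (t * v 0 j).
have gL : lip `|t| g.
  move=> x h; apply: le_trans (trunc_lip _ _ _) _.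
  rewrite mxE mulrDr addrAC subrr add0r normrM ler_wpM2l//.
  exact: coord_l1norm.
have gb := lip_C_bLip gL (fun x => trunc_bound (t * x 0 j) (ltW k0)).
have h1 := trunc_moment k0 (rvs_scale t (r1 j)) (rvs_lip r1 gL).
have h2 := trunc_moment k0 (rvs_scale t (r2 j)) (rvs_lip r2 gL).
have := id12 _ gb; rewrite /g => h3; rewrite h3 in h1.
have h4 : k^-1 * A + k^-1 * B <= e.
  rewrite -mulrDr ler_pdivrMl// /k mulrDl mulfVK ?gt_eqF// mul1r.
  by have := ler_norm A; have := ler_norm B; lra.
move: h1 h2; rewrite -/A -/B add0r !ler_norml => /andP[? ?] /andP[? ?].
by apply/andP; split; lra.
Qed.

(* The law of N + Nbar gives sqrt 2 * m = 2 * m. *)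
Lemma G_normal_mean (R : realType) (d : nat) (Omega : Type)
    (S : sublinear_space R Omega) (N : Omega -> 'rV[R]_d) (t : R) (j : 'I_d) :
  G_normal S N -> expect S (fun w => t * N w 0 j) = 0.
Proof.
move=> [rN [Nbar [[rNb idN iN] hN]]]; set m := expect S _.
have := hN 1 1 ler01 ler01; rewrite expr1n -[1 + 1]/2 => id2.
have rv2 : random_vector S (fun w => 1 *: N w + 1 *: Nbar w).
  move=> i; under eq_fun do rewrite !mxE !mul1r; exact: rvs_add.
have rvs2 : random_vector S (fun w => Num.sqrt 2 *: N w).
  by move=> i; under eq_fun do rewrite mxE; exact: rvs_scale.
have := ident_dist_mean t j rv2 rvs2 id2.
have -> : expect S (fun w => t * (Num.sqrt 2 *: N w) 0 j) = Num.sqrt 2 * m.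
  have -> : (fun w => t * (Num.sqrt 2 *: N w) 0 j) =
      (fun w => Num.sqrt 2 * (t * N w 0 j)).
    by apply/funext => w; rewrite mxE mulrCA.
  by rewrite expect_poshom ?sqrtr_ge0//; exact: rvs_scale.
pose f (v : 'rV[R]_d) := t * v 0 j.
have fL : lip `|t| f.
  move=> x h; rewrite /f mxE mulrDr addrAC subrr add0r normrM ler_wpM2l//.
  exact: coord_l1norm.
have := ident_dist_step 1 1 0 rN iN (normr_ge0 t) fL.
rewrite /f; under eq_fun do rewrite add0r.
move=> ->; rewrite /step.
have inner w : expect S (fun w0 => t * (0 + 1 *: N w + 1 *: Nbar w0) 0 j) =
    t * N w 0 j + m.
  rewrite /m -(ident_dist_mean t j rNb rN idN).
  have -> : (fun w0 => t * (0 + 1 *: N w + 1 *: Nbar w0) 0 j) =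
      (fun w0 => t * Nbar w0 0 j + t * N w 0 j).
    by apply/funext => w0; rewrite !mxE add0r !mul1r; ring.
  by rewrite addrC expect_addc//; exact: rvs_scale.
under eq_fun do rewrite inner.
have -> : expect S (fun w => t * N w 0 j + m) = m + m.
  by rewrite expect_addc//; exact: rvs_scale.
move=> h; have : (2 - Num.sqrt 2) * m = 0 by lra.
move/eqP; rewrite mulf_eq0 => /orP[|/eqP//].
rewrite subr_eq0 => /eqP s2; have : Num.sqrt 2 ^+ 2 = 2 :> R by rewrite sqr_sqrtr.
by rewrite -s2; lra.
Qed.

Lemma G_normal_centered (R : realType) (d : nat) (Omega : Type)
    (S : sublinear_space R Omega) (N : Omega -> 'rV[R]_d) :
  G_normal S N -> centered S (expect S (fun w => l1norm (N w) ^+ 3)) N.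
Proof.
move=> GN; split => [|j|]; [by case: GN | |by []]; split.
  by under eq_fun do rewrite -[_ 0 j]mul1r; exact: G_normal_mean.
by under eq_fun do rewrite -mulN1r; exact: G_normal_mean.
Qed.

Lemma centered_of_enorm (R : realType) (d : nat) (Omega : Type)
    (S : sublinear_space R Omega) (M : R) (Y : Omega -> 'rV[R]_d) :
  random_vector S Y ->
  (forall j, expect S (fun w => Y w 0 j) = 0 /\
             expect S (fun w => - Y w 0 j) = 0) ->
  expect S (fun w => enorm (Y w) ^+ 3) <= M ->
  centered S (d%:R ^+ 3 * M) Y.
Proof.
move=> rY mY MY; split => //.
have re : rvs S (fun w => enorm (Y w) ^+ 3) by exact/rvs_cube/(rvs_lip rY)/lip_enorm.
apply: le_trans (ler_wpM2l (exprn_ge0 3 (ler0n R d)) MY).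
rewrite -expect_poshom ?exprn_ge0//; apply: expect_mono.
- exact: rvs_scale.
- exact/rvs_cube/rvs_l1norm.
- move=> w; rewrite -exprMn ler_pXn2r ?nnegrE ?l1norm_ge0 ?l1norm_le_enorm//.
  by rewrite mulr_ge0// enorm_ge0.
Qed.

(** * Convergence in law of the normalized sums *)

Theorem theorem3p1 (R : realType) (d : nat)
  (Omega : Type) (S : sublinear_space R Omega)
  (X : nat -> Omega -> 'rV[R]_d)
  (X_rv : forall i, (1 <= i)%N -> random_vector S (X i))
  (X_indep : forall i, (1 <= i)%N ->
     independent_from S (X i.+1) (initial_vector X i))
  (X_mean : forall i, (1 <= i)%N -> forall j : 'I_d,
     expect S (fun w => X i w 0 j) = 0 /\ expect S (fun w => - X i w 0 j) = 0)
  (X_moment3 : exists2 M : R, 0 < M &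
     forall i, (1 <= i)%N -> expect S (fun w => enorm (X i w) ^+ 3) <= M)
  (a : nat -> R) (a_gt0 : forall n, (1 <= n)%N -> 0 < a n)
  (a_cesaro : (\sum_(1 <= i < n.+1) a i) / n%:R @[n --> \oo] --> 0)
  (G : 'M[R]_d -> R) (G_sublinear : sublinear_on_sym G)
  (G_approx : forall n, (1 <= n)%N -> forall A : 'M[R]_d, A \is symmetricmx ->
     `|2^-1 * expect S (fun w => quadform A (X n w)) - G A| <= a n * fnorm A)
  (Omega' : Type) (S' : sublinear_space R Omega')
  (Theta : set 'M[R]_d) (N : Omega' -> 'rV[R]_d)
  (N_normal : normal_dist S' G Theta N) :
  forall phi : 'rV[R]_d -> R, C_bLip phi ->
    expect S (fun w => phi ((Num.sqrt n%:R)^-1 *: \sum_(1 <= i < n.+1) X i w))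
      @[n --> \oo] --> expect S' (fun w => phi (N w)).

Proof.
move=> phi phib; have [_ GN GA _] := N_normal.
have [[B phiB] _] := phib; have [L L0 phiL] := C_bLip_lip phib.
have [M M0 MX] := X_moment3.
set M' := d%:R ^+ 3 * M; set M2 := expect S' (fun w => l1norm (N w) ^+ 3).
have cX k : centered S M' (X k.+1).
  by apply: centered_of_enorm; [exact: X_rv|exact: X_mean|exact: MX].
have cN (k : nat) : centered S' M2 N by exact: G_normal_centered.
have [rN _] := GN.
have hG k (H : 'M[R]_d) : H \is symmetricmx ->
    `|2^-1 * expect S (fun w => quadform H (X k.+1 w))
      - 2^-1 * expect S' (fun w => quadform H (N w))| <= a k.+1 * fnorm H.
  move=> Hs; rewrite -[X in _ - X]expect_poshom ?invr_ge0//; last exact: rvs_quadform.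
  by rewrite GA//; exact: G_approx.
have a0 k : 0 <= a k.+1 by exact/ltW/a_gt0.
(* Since sqrt n times 1/sqrt n is 1, N itself splits into n normal steps of the same size as the
   steps of the normalized sum. *)
have Nchain n : (0 < n)%N -> expect S' (fun w => phi (N w)) =
    chain S' (Num.sqrt n%:R)^-1 (fun=> N) (iota 0 n) phi 0.
  move=> n0; rewrite -(G_normal_chain n 0 GN _ L0 phiL phiB) ?invr_ge0 ?sqrtr_ge0//.
  rewrite mulfV; last by rewrite gt_eqF// sqrtr_gt0 ltr0n.
  by rewrite /step; under [in RHS]eq_fun do rewrite scale1r add0r.
have Mpos : 0 <= M' + M2.
  apply: addr_ge0; first by rewrite mulr_ge0 ?exprn_ge0// ltW.
  rewrite -(expect_cst S' 0); apply: expect_mono; [|exact: rvs_cst|].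
  - exact/rvs_cube/rvs_l1norm.
  - by move=> w; rewrite exprn_ge0// l1norm_ge0.
apply/cvgrPdist_le => e e0.
(* The smoothing width takes half of e. It is fixed before n, so the constants C1 and C2 obtained
   from it do not vary with n. *)
pose eps := e / 2 / (d%:R * 4 * L + 1).
have D0 : 0 < d%:R * 4 * L + 1 by rewrite ltr_wpDl// !mulr_ge0.
have eps0 : 0 < eps by rewrite !divr_gt0.
have epsE : d%:R * 4 * L * eps <= e / 2.
  by rewrite /eps mulrCA ler_piMr ?divr_ge0 ?(ltW e0)// ler_pdivrMr// mul1r ler_wpDr.
have [C1 C10 hC1] := chain_le L0 eps0 cX cN a0 hG.
have hG' k (H : 'M[R]_d) : H \is symmetricmx ->
    `|2^-1 * expect S' (fun w => quadform H (N w))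
      - 2^-1 * expect S (fun w => quadform H (X k.+1 w))| <= a k.+1 * fnorm H.
  by rewrite distrC; exact: hG.
have [C2 C20 hC2] := chain_le L0 eps0 cN cX a0 hG'.
(* One constant for both directions; the summand 1 allows division by it. *)
pose C := C1 + C2 + 1; have C0 : 0 < C by rewrite /C; lra.
have e4 : 0 < e / 4 / C by rewrite !divr_gt0.
near=> n.
have n0 : (0 < n)%N by near: n; exact: nbhs_infty_gt.
have nR : 0 < n%:R :> R by rewrite ltr0n.
have ha : (\sum_(1 <= i < n.+1) a i) / n%:R <= e / 4 / C.
  near: n; move/cvgrPdist_le : a_cesaro => /(_ _ e4); apply: filterS => n.
  by rewrite sub0r normrN; apply: le_trans; exact: ler_norm.
have hM : (Num.sqrt n%:R)^-1 * (M' + M2) <= e / 4 / C.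
  have : ((M' + M2) / (e / 4 / C)) ^+ 2 <= n%:R.
    by near: n; exact: nbhs_infty_ger.
  move=> /ler_wsqrtr; rewrite sqrtr_sqr ger0_norm; last by rewrite divr_ge0// ltW.
  by rewrite ler_pdivrMr// ler_pdivrMl ?sqrtr_gt0.
set c := (Num.sqrt n%:R)^-1 in hM *.
have c0 : 0 <= c by rewrite invr_ge0 sqrtr_ge0.
have c2 : c ^+ 2 = n%:R^-1 by rewrite exprVn sqr_sqrtr ?ler0n.
(* As c^2 = 1/n, the covariance errors form the Cesaro mean of a, and the n cubic errors add up to n
   c^3 = c times the moment bound. Both tend to 0. *)
have sumE : \sum_(k <- iota 0 n) (c ^+ 2 * a k.+1 + c ^+ 3 * (M' + M2)) =
    (\sum_(1 <= i < n.+1) a i) / n%:R + c * (M' + M2).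
  rewrite big_split/= -mulr_sumr c2 mulrC; congr (_ / _ + _).
    by rewrite big_add1/= /index_iota subn0.
  rewrite big_const_seq count_predT iter_addr_0 size_iota -mulr_natl.
  by rewrite exprSr c2 !mulrA mulfV ?mul1r// gt_eqF.
set T := \sum_(k <- iota 0 n) _ in sumE.
have T1 : T <= e / 2 / C.
  by rewrite sumE; apply: le_trans (lerD ha hM) _; lra.
have T0 : 0 <= T.
  rewrite sumE addr_ge0 ?mulr_ge0 ?invr_ge0// big_add1/=.
  by apply: sumr_ge0 => i _; exact: a0.
have CT : C * T <= e / 2 by rewrite mulrC -ler_pdivlMr.
rewrite (Nchain n n0) (expect_partial_sum n c X_rv X_indep L0 phiL) -/c.
(* The normal chain is bounded by that of the sums, and then the other way round. *)
have h1 := hC1 phi c (iota 0 n) 0 phiL c0.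
have h2 := hC2 phi c (iota 0 n) 0 phiL c0.
rewrite (addrC M2) -/T in h2; rewrite -/T in h1.
have t1 : 0 <= C1 * T by rewrite mulr_ge0.
have t2 : 0 <= C2 * T by rewrite mulr_ge0.
move: CT; rewrite /C !mulrDl mul1r => CT.
by rewrite ler_norml; apply/andP; split; lra.
Unshelve. all: by end_near.
Qed.
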